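(* Let $K\ge 1$ be a fixed integer and let $(S,\mathcal{S})$ be a measurable space. Let $\{X_{\bm{i}}:\bm{i}\in\mathbb{N}^K\}$ be an array of $S$-valued random variables that is separately exchangeable and dissociated, represented as $X_{\bm{i}}=\tau(\{U_{\bm{i}\odot\bm{e}}\}_{\bm{e}\in\{0,1\}^K\setminus\{\bm{0}\}})$ with i.i.d. $U$'s as described in the context. Let $\mathcal{F}$ be a pointwise measurable class of functions $f:S\to\mathbb{R}$ with envelope $F$, and with $\mathbb{E}[f(X_{\bm{1}})]=0$ for all $f\in\mathcal{F}$. Fix $1\le k\le K$ and $\bm{e}\in\mathcal{E}_k$. Then for every $q\in[1,\infty)$, \[ |I_{\bm{N},\bm{e}}|^{1/2}\Big(\mathbb{E}\Big[\sup_{f\in\mathcal{F}}|H^{\bm{e}}_{\bm{N}}(f)|^q\Big]\Big)^{1/q}\le C\, J_{\bm{e}}(1)\,\|F\|_{P,q\vee 2}, \] where $C$ is a constant depending only on $q$, $K$ and $k$, and $\|F\|_{P,r}=(\mathbb{E}[F(X_{\bm{1}})^r])^{1/r}$.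
   Context: Separate exchangeability (SE): for every $K$-tuple $\pi=(\pi_1,\dots,\pi_K)$ of permutations of $\mathbb{N}$, the arrays $\{X_{\bm{i}}\}_{\bm{i}\in\mathbb{N}^K}$ and $\{X_{(\pi_1(i_1),\dots,\pi_K(i_K))}\}_{\bm{i}\in\mathbb{N}^K}$ have the same distribution. Dissociation (D): for index sets $I,I'\subset\mathbb{N}^K$ that share no common value in any coordinate, $\{X_{\bm{i}}\}_{\bm{i}\in I}$ and $\{X_{\bm{i}}\}_{\bm{i}\in I'}$ are independent. Under (SE) and (D) (Aldous–Hoover–Kallenberg), we fix a representation $X_{\bm{i}}=\tau(\{U_{\bm{i}\odot\bm{e}}\}_{\bm{e}\in\{0,1\}^K\setminus\{\bm{0}\}})$, where $\odot$ is the coordinatewise product, $\{U_{\bm{i}\odot\bm{e}}:\bm{i}\in\mathbb{N}^K,\bm{e}\in\{0,1\}^K\setminus\{\bm 0\}\}$ are i.i.d. random variables and $\tau$ is Borel measurable. $\bm{1}=(1,\dots,1)$. A class $\mathcal{F}$ is pointwise measurable if there is a countable $\mathcal{F}'\subset\mathcal{F}$ such that every $f\in\mathcal{F}$ is a pointwise limit of a sequence in $\mathcal{F}'$. $F:S\to[0,\infty)$ is an envelope if $\sup_{f\in\mathcal{F}}|f(x)|\le F(x)$ for all $x$. The observed sample is $\{X_{\bm{i}}:\bm{i}\in[\bm{N}]\}$ with $\bm{N}=(N_1,\dots,N_K)$, $[\bm{N}]=\prod_{k=1}^K\{1,\dots,N_k\}$. For $k\in\{1,\dots,K\}$, $\mathcal{E}_k=\{\bm{e}\in\{0,1\}^K:\sum_j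 e_j=k\}$; $\mathrm{supp}(\bm{e})=\{j:e_j\neq 0\}$; for vectors, $\bm{e}'\le\bm{e}$ means coordinatewise, and below $\bm{e}'$ ranges over nonzero elements of $\{0,1\}^K$. For $\bm{e}\ne\bm 0$ and $f$, $(P_{\bm{e}}f)(\{U_{\bm{i}\odot\bm{e}'}\}_{\bm{e}'\le\bm{e}})=\mathbb{E}[f(X_{\bm{i}})\mid\{U_{\bm{i}\odot\bm{e}'}\}_{\bm{e}'\le\bm{e}}]$. Recursively, $\pi_{\bm{e}}f=P_{\bm{e}}f$ for $\bm{e}\in\mathcal{E}_1$, and for $\bm{e}\in\mathcal{E}_k$, $k\ge2$, $(\pi_{\bm{e}}f)(\{U_{\bm{i}\odot\bm{e}'}\}_{\bm{e}'\le\bm{e}})=(P_{\bm{e}}f)(\{U_{\bm{i}\odot\bm{e}'}\}_{\bm{e}'\le\bm{e}})-\sum_{\bm{e}'\le\bm{e},\bm{e}'\ne\bm{e}}(\pi_{\bm{e}'}f)(\{U_{\bm{i}\odot\bm{e}''}\}_{\bm{e}''\le\bm{e}'})$. Let $I_{\bm{N},\bm{e}}=\{\bm{i}\odot\bm{e}:\bm{i}\in[\bm{N}]\}$, so $|I_{\bm{N},\bm{e}}|=\prod_{j\in\mathrm{supp}(\bm{e})}N_j$, and $H^{\bm{e}}_{\bm{N}}(f)=|I_{\bm{N},\bm{e}}|^{-1}\sum_{\bm{i}\in I_{\bm{N},\bm{e}}}(\pi_{\bm{e}}f)(\{U_{\bm{i}\odot\bm{e}'}\}_{\bm{e}'\le\bm{e}})$.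 Write $P_{\bm{e}}\mathcal{F}=\{P_{\bm{e}}f:f\in\mathcal{F}\}$ and $P_{\bm{e}}F$ for the function defined analogously from $F$. For $\bm{e}\in\mathcal{E}_k$, the uniform entropy integral is $J_{\bm{e}}(\delta)=\int_0^\delta\sup_Q\{1+\log N(P_{\bm{e}}\mathcal{F},\|\cdot\|_{Q,2},\tau\|P_{\bm{e}}F\|_{Q,2})\}^{k/2}d\tau$, where the supremum is over finitely discrete probability measures $Q$, $\|g\|_{Q,2}=(Q|g|^2)^{1/2}$, and $N(T,d,\varepsilon)$ is the $\varepsilon$-covering number. *)

(* Defs.v *)
From Stdlib Require List.
From HB Require Import structures.
From mathcomp Require Import all_boot all_order all_algebra.
From mathcomp Require Import all_classical all_reals all_analysis.
Set Implicit Arguments. Unset Strict Implicit. Unset Printing Implicit Defensive.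
Import Order.TTheory GRing.Theory Num.Theory.
Import numFieldNormedType.Exports.
Local Open Scope classical_set_scope.
Local Open Scope ring_scope.

(* Conventions:
   - a vector e in {0,1}^K \ {0} is represented by its support A : {set 'I_K},
     A != set0; e' <= e  iff  A' \subset A;  e in E_k iff #|A| = k.
   - a multi-index i in N^K (or N_0^K) is a {ffun 'I_K -> nat}.
   - the family {U_{i.e}}_{e != 0} is a family indexed by {set 'I_K}; it is
     passed to tau as a tuple with one slot per subset of 'I_K (the slot of
     set0 is filled with the constant 0 and plays no role). *)

Section Defs.
Variable R : realType.
Variable K : nat.

Definition idx := {ffun 'I_K -> nat}.
Definition sub := {set 'I_K}.
Definition ntup := #|{: sub}|.
Definition famT := ntup.-tuple R.

Definition odot (i : idx) (A : sub) : idx := [ffun j => if j \in A then i j else 0%N].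
Definition one_idx : idx := [ffun _ => 1%N].
Definition zero_idx : idx := [ffun _ => 0%N].

Definition tau_in (u : sub -> R) : famT :=
  [tuple (if #|enum_val j| == 0%N then 0 else u (enum_val j)) | j < ntup].

Definition mutually_independent {dO} {I : eqType} {Om : measurableType dO}
  (P : probability Om R) (D : set I) (X : I -> Om -> R) : Prop :=
  forall (s : seq I) (B : I -> set R), uniq s -> (forall i, i \in s -> D i) ->
    (forall i, measurable (B i)) ->
    P (\bigcap_(i in [set` s]) (X i @^-1` B i)) = (\prod_(i <- s) P (X i @^-1` B i))%E.

Definition iid {dO} {I : eqType} {Om : measurableType dO}
  (P : probability Om R) (D : set I) (X : I -> Om -> R) : Prop :=
  [/\ (forall i, D i -> measurable_fun setT (X i)),
      mutually_independent P D X &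
      (forall i j (B : set R), D i -> D j -> measurable B ->
          P (X i @^-1` B) = P (X j @^-1` B))].

Context {d : measure_display} {S : measurableType d}
        {dO : measure_display} {Om : measurableType dO}.
Variables (P : probability Om R) (U : idx -> Om -> R) (tau : famT -> S).

Definition Xarr (i : idx) (w : Om) : S := tau (tau_in (fun B => U (odot i B) w)).

(* (P_e f)({u_{e'}}_{e' <= e}) = E[f(X_i) | {U_{i.e'}}_{e' <= e}], written, using the
   independence of the U's, by integrating out the U's not indexed by some e' <= e *)
Definition Pe (f : S -> R) (A : sub) (u : sub -> R) : R :=
  fine (\int[P]_w (f (tau (tau_in (fun B => if B \subset A then u B
                                           else U (odot one_idx B) w))))%:E).

(* recursive Hoeffding-type projection pi_e, with fuel = |e| *)
Fixpoint pi_rec (f : S -> R) (m : nat) (A : sub) (u : sub -> R) : R :=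
  match m with
  | 0 => 0
  | m'.+1 => Pe f A u -
      \sum_(B : sub | (B \proper A) && (0 < #|B|)%N) pi_rec f m' B u
  end.
Definition pie (f : S -> R) (A : sub) (u : sub -> R) : R := pi_rec f #|A| A u.

Definition cardI (N : 'I_K -> nat) (A : sub) : nat := (\prod_(j in A) N j)%N.

(* H^e_N(f): average over I_{N,e} = { i.e : i in [N] }.  An element of I_{N,e} is
   encoded by t with t j < N j (value (t j).+1 in coordinate j in A) and t j = 0 for
   j outside A. *)
Definition Hen (N : 'I_K -> nat) (f : S -> R) (A : sub) (w : Om) : R :=
  (cardI N A)%:R^-1 *
  \sum_(t : {dffun forall j : 'I_K, 'I_(N j)} |
          [forall j, (j \notin A) ==> (val (t j) == 0%N)])
     pie f A (fun B => U (odot [ffun j => (val (t j)).+1] B) w).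

End Defs.

Section Entropy.
Variable R : realType.
Variable D : Type.

Definition fin_discrete_prob (Q : seq (D * R)) : Prop :=
  (forall p, Stdlib.Lists.List.In p Q -> 0 <= p.2) /\ \sum_(p <- Q) p.2 = 1.

Definition Qnorm2 (Q : seq (D * R)) (g : D -> R) : R :=
  Num.sqrt (\sum_(p <- Q) p.2 * (g p.1) ^+ 2).

Definition covers (Q : seq (D * R)) (T : set (D -> R)) (eps : R) (n : nat) : Prop :=
  exists c : 'I_n -> (D -> R),
    forall g, T g -> exists j : 'I_n, Qnorm2 Q (fun x => g x - c j x) <= eps.

(* {1 + log N(T, ||.||_{Q,2}, eps)}^{k/2}, +oo if no finite cover exists *)
Definition ent_term (k : nat) (Q : seq (D * R)) (T : set (D -> R)) (eps : R) : \bar R :=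
  ereal_inf [set ((1 + ln n%:R) `^ (k%:R / 2))%:E | n in [set n | covers Q T eps n]].

Definition unif_entropy_integral (k : nat) (T : set (D -> R)) (G : D -> R) (delta : R) : \bar R :=
  (\int[@lebesgue_measure R]_(t in [set t : R | (0 <= t <= delta)%R])
     ereal_sup [set ent_term k Q T (t * Qnorm2 Q G)%R | Q in [set Q | fin_discrete_prob Q]])%E.

End Entropy.

Definition pointwise_measurable {R : realType} {S : Type} (F : set (S -> R)) : Prop :=
  exists F' : set (S -> R), countable F' /\ F' `<=` F /\
    forall f, F f -> exists g : nat -> S -> R, (forall n, F' (g n)) /\
      forall x, g n x @[n --> \oo] --> f x.

Definition envelope {R : realType} {S : Type} (F : set (S -> R)) (G : S -> R) : Prop :=
  forall x, 0 <= G x /\ forall f, F f -> `|f x| <= G x.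

(* Main.v *)
Require Import Defs.
From HB Require Import structures.
From mathcomp Require Import all_boot all_order all_algebra.
From mathcomp Require Import all_classical all_reals all_analysis.
From mathcomp Require Import measurable_realfun ring lra zify.
Set Implicit Arguments. Unset Strict Implicit. Unset Printing Implicit Defensive.
Import Order.TTheory GRing.Theory Num.Theory.
Import numFieldNormedType.Exports.
Local Open Scope classical_set_scope.
Local Open Scope ring_scope.

(** Symmetrization needs neither conditioning nor an independent copy of the whole array. Fix a
    sign for every value of the index in every direction of [A], and let [eps_i] be the product of
    the signs met by the multi-index [i]. In each direction resample either the entries with sign
    [+1] or those with sign [-1]. Up to the sign of the choice, averaging
    [sum_i eps_i (P_e f)(i)] over the resampled entries and adding over the [2 ^ #|A|] choices
    gives the Moebius sum of the [P_e' f], that is [sum_i (pi_e f)(i)]: a direction in which [i] is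
    resampled removes this direction from [e]. Since resampling preserves the law of the array,
    the [L^q] norm of the supremum over the class grows at most by a constant factor when [pi_e f]
    is replaced by [eps_i P_e f], for every fixed choice of signs, hence on average over the signs.

    Given the array, the average over the signs is that of a homogeneous Rademacher chaos of degree
    [k], whose even moments are bounded by Bonami's inequality. Chaining over dyadic covers for the
    empirical measure of the sample bounds it by the entropy integral times the empirical [L^2] norm
    of [P_e F]; since the sample is finite, the last link of the chain is bounded pointwise and
    finitely many levels suffice. Jensen's inequality then compares the moments of [P_e F] with
    those of [F]. *)

(** One sign pattern and one choice [s] treat all multi-indices at once: [i] keeps the directions in
    which its sign differs from [s], and the Moebius sign of the kept set is [eps_i] times a
    coefficient that depends on [s] only. Because of this factorization the sum over [i] can be
    formed before the supremum is taken. Two obstacles shape the rest. The supremum over the class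
    is not known to be measurable, so its integral is bounded through a measurable majorant built
    from a sequence in the class whose subsequential pointwise limits reach every member. And [Pe]
    applies [fine] to an integral, so it is a genuine conditional mean only where the sections are
    integrable; pathwise estimates are restricted to such points, which have full measure. Jensen's
    inequality enters in a weak form, with a loss [2 ^ q], obtained from a linear bound of [x] by
    [x ^ q]. *)

(** * Elementary inequalities for finite sums *)

Section FiniteSums.
Variable R : realFieldType.

(** From [j] to [j + 1] the quotient of the two binomials is multiplied by
    [(2m - 2j - 1) / (2j + 1)], which is at most [2m]. *)
Lemma bin_double_le (m j : nat) :
  ('C(m.*2, j.*2) <= 'C(m, j) * m.*2 ^ j)%N.
Proof.
elim: j => [|j IH]; first by rewrite !bin0.
have [jm|jm] := ltnP j m; last first.
  by rewrite bin_small// doubleS; lia.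
have E1 : ((j.*2.+1 * j.*2.+2) * 'C(m.*2, j.*2.+2) =
  (m.*2 - j.*2) * (m.*2 - j.*2.+1) * 'C(m.*2, j.*2))%N.
  have A1 := mul_bin_left m.*2 j.*2; have A2 := mul_bin_left m.*2 j.*2.+1.
  by rewrite -mulnA A2 mulnCA A1 mulnCA mulnA.
have E2 := mul_bin_left m j.
rewrite doubleS.
rewrite -(leq_pmul2l (_ : 0 < j.*2.+1 * j.*2.+2)%N)// E1.
apply: leq_trans (leq_mul (leqnn _) IH) _.
have -> : (j.*2.+1 * j.*2.+2 * ('C(m, j.+1) * m.*2 ^ j.+1) =
  j.*2.+1 * 2 * m.*2 * m.*2 ^ j * (j.+1 * 'C(m, j.+1)))%N.
  by rewrite expnS; lia.
rewrite E2.
have -> : (j.*2.+1 * 2 * m.*2 * m.*2 ^ j * ((m - j) * 'C(m, j)) =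
  (j.*2.+1 * 2 * m.*2 * (m - j)) * ('C(m, j) * m.*2 ^ j))%N by ring.
rewrite leq_mul2r; apply/orP; right.
rewrite -doubleB -mul2n.
have -> : (j.*2.+1 * 2 * m.*2 * (m - j) = 2 * (m - j) * m.*2 * j.*2.+1)%N by ring.
apply: (@leq_trans (2 * (m - j) * m.*2)); last exact: leq_pmulr.
by rewrite leq_mul2l leq_subr orbT.
Qed.

(** The two-point case of hypercontractivity. The odd powers of [b] cancel, and the even ones are
    compared coefficient by coefficient through [bin_double_le]. *)
Lemma two_point_le (m : nat) (a b : R) :
  (a + b) ^+ m.*2 + (a - b) ^+ m.*2 <= 2 * (a ^+ 2 + m.*2%:R * b ^+ 2) ^+ m.
Proof.
have even_odd (F : nat -> R) n :
    \sum_(i < n.*2.+1) F i = \sum_(i < n.+1) F i.*2 + \sum_(i < n) F i.*2.+1.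
  elim: n => [|n IH]; first by rewrite !big_ord_recr !big_ord0 /= !addr0.
  rewrite doubleS big_ord_recr big_ord_recr/= IH [\sum_(i < n.+2) _]big_ord_recr/=.
  by rewrite [\sum_(i < n.+1) F i.*2.+1]big_ord_recr/= doubleS; ring.
rewrite exprDn exprBn -big_split/=.
rewrite (even_odd (fun i => a ^+ (m.*2 - i) * b ^+ i *+ 'C(m.*2, i) +
      (-1) ^+ i * a ^+ (m.*2 - i) * b ^+ i *+ 'C(m.*2, i)))/= [X in _ + X]big1 ?addr0; last first.
  by move=> i _; rewrite -signr_odd/= odd_double/= expr1 mulN1r mulNr mulNrn addrN.
rewrite exprDn mulr_sumr ler_sum// => i _.
rewrite -signr_odd odd_double expr0 mul1r -mulr2n -[X in X <= _]mulr_natl ler_pM2l//.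
rewrite -doubleB -[(m - i).*2]mul2n -[i.*2]mul2n !exprM [(_ * b ^+ 2) ^+ i]exprMn.
rewrite -[X in X <= _]mulr_natl -[X in _ <= X]mulr_natl.
set x := (a ^+ 2) ^+ _; set y := (b ^+ 2) ^+ _.
have -> : 'C(m, i)%:R * (x * (m.*2%:R ^+ i * y)) = ('C(m, i)%:R * m.*2%:R ^+ i) * (x * y).
  by ring.
rewrite ler_wpM2r//; first by rewrite mulr_ge0// exprn_ge0// sqr_ge0.
by rewrite mul2n -natrX -natrM ler_nat bin_double_le.
Qed.

(* Minkowski's inequality in [l^m], with the roots eliminated. *)
Lemma sum_expD_le (E : finType) (m : nat) (u v : E -> R) (c a b : R) :
  (forall x, 0 <= u x) -> (forall x, 0 <= v x) -> 0 <= a -> 0 <= b ->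
  0 <= c ->
  \sum_x u x ^+ m <= c * a ^+ m -> \sum_x v x ^+ m <= c * b ^+ m ->
  \sum_x (u x + v x) ^+ m <= c * (a + b) ^+ m.
Proof.
case: m => [|m] u0 v0 a0 b0 c0 ha hb; first by rewrite expr0 in ha *.
have zero w (d : R) : (forall x, 0 <= w x) -> d = 0 ->
    \sum_x w x ^+ m.+1 <= c * d ^+ m.+1 -> forall x : E, w x = 0.
  move=> w0 -> ; rewrite expr0n/= mulr0 => h x.
  have /eqP : \sum_x w x ^+ m.+1 == 0.
    by rewrite eq_le h sumr_ge0// => y _; rewrite exprn_ge0.
  move/psumr_eq0P => /(_ (fun y _ => exprn_ge0 _ (w0 y))) /(_ x isT) /eqP.
  by rewrite expf_eq0/= => /eqP.
have [a00|an0] := eqVneq a 0.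
  have u00 := zero _ _ u0 a00 ha; rewrite a00 add0r.
  by under eq_bigr do rewrite u00 add0r.
have [b00|bn0] := eqVneq b 0.
  have v00 := zero _ _ v0 b00 hb; rewrite b00 addr0.
  by under eq_bigr do rewrite v00 addr0.
have ap : 0 < a by rewrite lt_def an0. have bp : 0 < b by rewrite lt_def bn0.
have conv (x y s : R) n : 0 <= x -> 0 <= y -> 0 <= s <= 1 ->
    (s * x + (1 - s) * y) ^+ n <= s * x ^+ n + (1 - s) * y ^+ n.
  move=> x0 y0 /andP[s0 s1]; elim: n => [|n IH]; first by rewrite !expr0; lra.
  rewrite exprS; have z0 : 0 <= s * x + (1 - s) * y.
    by rewrite addr_ge0// mulr_ge0// subr_ge0.
  apply: le_trans (ler_wpM2l z0 IH) _.
  rewrite -subr_ge0 !exprS.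
  have -> : s * (x * x ^+ n) + (1 - s) * (y * y ^+ n) -
   (s * x + (1 - s) * y) * (s * x ^+ n + (1 - s) * y ^+ n) =
   s * (1 - s) * ((x - y) * (x ^+ n - y ^+ n)) by ring.
  rewrite mulr_ge0//; first by rewrite mulr_ge0// subr_ge0.
  have [xy|yx] := leP x y.
    by rewrite mulr_le0// subr_le0// lerXn2r.
  by rewrite mulr_ge0// subr_ge0 ?lerXn2r// ltW.
(* With these weights [u + v] is [a + b] times a convex combination of [u / a] and [v / b], so
   convexity of the power applies pointwise. *)
set s := a / (a + b).
have ab : 0 < a + b by lra.
have s01 : 0 <= s <= 1.
  by rewrite /s divr_ge0 ?(ltW ab)//= ler_pdivrMr// mul1r lerDl.
have s1E : 1 - s = b / (a + b) by rewrite /s; field; lra.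
have step x : (u x + v x) ^+ m.+1 <= (a + b) ^+ m.+1 *
    (s * (u x ^+ m.+1 / a ^+ m.+1) + (1 - s) * (v x ^+ m.+1 / b ^+ m.+1)).
  have -> : u x + v x = (a + b) * (s * (u x / a) + (1 - s) * (v x / b)).
    by rewrite s1E /s; field; rewrite an0 bn0; lra.
  rewrite exprMn ler_pM2l ?exprn_gt0//.
  apply: le_trans (conv _ _ _ _ _ _ s01) _; [exact: divr_ge0|exact: divr_ge0|].
  by rewrite !expr_div_n.
apply: le_trans (ler_sum _ (fun x _ => step x)) _.
rewrite -mulr_sumr mulrC ler_wpM2r ?(exprn_ge0 _ (ltW ab))//.
rewrite big_split/= -!mulr_sumr -!mulr_suml.
have ha' : (\sum_x u x ^+ m.+1) / a ^+ m.+1 <= c by rewrite ler_pdivrMr ?exprn_gt0.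
have hb' : (\sum_x v x ^+ m.+1) / b ^+ m.+1 <= c by rewrite ler_pdivrMr ?exprn_gt0.
case/andP: s01 => s0 s1.
apply: (@le_trans _ _ (s * c + (1 - s) * c)); last by lra.
by apply: lerD; apply: ler_wpM2l => //; rewrite subr_ge0.
Qed.

End FiniteSums.

(** * Walsh functions and Bonami's inequality *)

Section Rademacher.
Variables (R : realFieldType) (J : finType).
Implicit Types (eps : {ffun J -> bool}) (X S : {set J}).

Definition sgb (b : bool) : R := if b then 1 else -1.
Definition walsh S eps : R := \prod_(x in S) sgb (eps x).
Definition flip (x : J) eps : {ffun J -> bool} :=
  [ffun y => if y == x then ~~ eps y else eps y].

Lemma flipK x : involutive (flip x).
Proof. by move=> eps; apply/ffunP => y; rewrite !ffunE; case: eqP => //; rewrite negbK. Qed.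

Lemma walsh_flip x S eps : x \notin S -> walsh S (flip x eps) = walsh S eps.
Proof.
move=> xS; apply: eq_bigr => y yS; rewrite ffunE; case: eqP => // yx.
by rewrite yx (negbTE xS) in yS.
Qed.

Lemma sgb_sqr b : sgb b ^+ 2 = 1.
Proof. by case: b; rewrite /= ?expr1n ?sqrrN ?expr1n. Qed.

Lemma walsh_norm S eps : `|walsh S eps| = 1.
Proof.
by rewrite normr_prod big1// => x _; rewrite /sgb; case: (eps x); rewrite ?normrN normr1.
Qed.

Lemma big_subsetU1 (V : nmodType) x X (f : {set J} -> V) : x \notin X ->
  \sum_(S : {set J} | S \subset x |: X) f S =
  \sum_(S : {set J} | S \subset X) f S + \sum_(S : {set J} | S \subset X) f (x |: S).
Proof.
move=> xX; rewrite (bigID (fun S => x \notin S))/=; congr (_ + _).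
  apply: eq_bigl => S; apply/andP/idP => [[Sx xS]|SX].
    apply/fintype.subsetP => y yS; move/fintype.subsetP: Sx => /(_ y yS); rewrite !inE => /orP[/eqP yx|//].
    by rewrite yx (negbTE xS) in yS.
  split; first by rewrite (fintype.subset_trans SX)// finset.subsetUr.
  by apply: contra xX; apply/fintype.subsetP.
rewrite (reindex_onto (fun S => x |: S) (fun S => S :\ x))/=; last first.
  by move=> S /andP[_]; rewrite negbK => xS; rewrite finset.setD1K.
apply: eq_bigl => S; rewrite finset.setU11/= andbT.
apply/andP/idP => [[SX /eqP <-]|SX].
  apply/fintype.subsetP => y; rewrite !inE => /andP[yx].
  by rewrite (negbTE yx)/= => yS; move/fintype.subsetP: SX => /(_ y); rewrite !inE yS (negbTE yx) orbT; apply.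
split; first by rewrite finset.setUS.
by rewrite finset.setU1K//; apply: contra xX; apply/fintype.subsetP.
Qed.

(** Induction on the number of signs. Isolating the sign of [x] writes the polynomial as
    [a + eps_x b] with [a], [b] free of that sign; flipping it allows [two_point_le], which leaves
    [(a ^ 2 + 2m b ^ 2) ^ m]. Minkowski's inequality in [l^m] separates the two squares, and the
    induction hypothesis applies to each. *)
Lemma bonami (m : nat) X (c : {set J} -> R) :
  \sum_eps (\sum_(S : {set J} | S \subset X) c S * walsh S eps) ^+ m.*2 <=
  #|{ffun J -> bool}|%:R *
    (\sum_(S : {set J} | S \subset X) m.*2%:R ^+ #|S| * c S ^+ 2) ^+ m.
Proof.
have [n] := ubnP #|X|; elim: n X c => // n IH X c leX.
have [->|[x xX]] := finset.set_0Vmem X.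
  have P0 : (fun S : {set J} => S \subset finset.set0) =1 pred1 finset.set0.
    by move=> S; rewrite finset.subset0.
  under eq_bigr do rewrite (big_pred1 _ P0).
  rewrite (big_pred1 _ P0).
  under eq_bigr do rewrite /walsh big_set0 mulr1.
  by rewrite sumr_const cards0 expr0 mul1r -exprM mul2n mulr_natl.
pose X' := X :\ x.
have xX' : x \notin X' by rewrite !inE eqxx.
have XE : X = x |: X' by rewrite finset.setD1K.
have leX' : (#|X'| < n)%N.
  by move: leX; rewrite XE cardsU1 xX' add1n ltnS.
pose a eps : R := \sum_(S : {set J} | S \subset X') c S * walsh S eps.
pose b eps : R := \sum_(S : {set J} | S \subset X') c (x |: S) * walsh S eps.
have fE eps : \sum_(S : {set J} | S \subset X) c S * walsh S eps = a eps + sgb (eps x) * b eps.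
  rewrite XE big_subsetU1//; congr (_ + _); rewrite mulr_sumr; apply: eq_bigr => S SX.
  rewrite /walsh big_setU1/= 1?mulrCA//.
  by apply: contra xX'; apply/fintype.subsetP.
have nS S : S \subset X' -> x \notin S by move=> SX; apply: contra xX'; apply/fintype.subsetP.
have af eps : a (flip x eps) = a eps.
  by apply: eq_bigr => S SX; rewrite walsh_flip// nS.
have bf eps : b (flip x eps) = b eps.
  by apply: eq_bigr => S SX; rewrite walsh_flip// nS.
under eq_bigr do rewrite fE.
have symE : \sum_eps (a eps + sgb (eps x) * b eps) ^+ m.*2 =
    \sum_eps (a eps - sgb (eps x) * b eps) ^+ m.*2.
  rewrite (reindex_inj (inv_inj (flipK x)))/=; apply: eq_bigr => eps _.
  rewrite af bf ffunE eqxx; congr (_ ^+ _); congr (_ + _).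
  by rewrite -mulNr /sgb; case: (eps x); rewrite ?opprK.
have le1 : \sum_eps (a eps + sgb (eps x) * b eps) ^+ m.*2 <=
    \sum_eps (a eps ^+ 2 + m.*2%:R * b eps ^+ 2) ^+ m.
  rewrite -(ler_pM2l (_ : 0 < 2))// [in leRHS]mulr_sumr [X in X <= _]mulr_natl mulr2n {2}symE.
  rewrite -big_split/= ler_sum// => eps _; apply: le_trans (two_point_le _ _ _) _.
  by rewrite exprMn sgb_sqr mul1r.
apply: le_trans le1 _.
rewrite XE big_subsetU1//.
apply: sum_expD_le.
- by move=> eps; exact: sqr_ge0.
- by move=> eps; rewrite mulr_ge0// sqr_ge0.
- by rewrite sumr_ge0// => S _; rewrite mulr_ge0 ?sqr_ge0 ?exprn_ge0.
- by rewrite sumr_ge0// => S _; rewrite mulr_ge0 ?sqr_ge0 ?exprn_ge0.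
- by [].
- by under eq_bigr do rewrite -exprM mul2n; apply: IH.
- under eq_bigr do rewrite exprMn -exprM mul2n.
  rewrite -mulr_sumr.
  have -> : \sum_(S : {set J} | S \subset X') m.*2%:R ^+ #|x |: S| * c (x |: S) ^+ 2 =
     m.*2%:R * \sum_(S : {set J} | S \subset X') m.*2%:R ^+ #|S| * c (x |: S) ^+ 2.
    rewrite mulr_sumr; apply: eq_bigr => S SX.
    by rewrite cardsU1 nS// add1n exprS -mulrA.
  rewrite [in leRHS]exprMn mulrCA ler_wpM2l ?exprn_ge0//.
  exact: (IH X' (fun S => c (x |: S))).
Qed.

(** By injectivity every Walsh coefficient [c S] has at most one term, and homogeneity makes the
    Bonami weight the constant [(2m) ^ k]. *)
Lemma chaos_moment (m k : nat) (I : finType) (p : pred I) (Sx : I -> {set J})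
    (a : I -> R) :
  {in p &, injective Sx} -> (forall t, p t -> #|Sx t| = k) ->
  \sum_eps (\sum_(t | p t) a t * walsh (Sx t) eps) ^+ m.*2 <=
  #|{ffun J -> bool}|%:R * (m.*2%:R ^+ k * \sum_(t | p t) a t ^+ 2) ^+ m.
Proof.
move=> inj cardS.
pose c S := \sum_(t | p t && (Sx t == S)) a t.
have cE eps : \sum_(t | p t) a t * walsh (Sx t) eps =
    \sum_(S : {set J} | S \subset [set: J]%SET) c S * walsh S eps.
  rewrite (partition_big Sx (fun S => S \subset [set: J]%SET))/=; last by move=> t _; rewrite finset.subsetT.
  by apply: eq_bigr => S _; rewrite mulr_suml; apply: eq_bigr => t /andP[_ /eqP ->].
under eq_bigr do rewrite cE.
apply: le_trans (bonami _ _ _) _.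
suff -> : \sum_(S : {set J} | S \subset [set: J]%SET) m.*2%:R ^+ #|S| * c S ^+ 2 =
  m.*2%:R ^+ k * \sum_(t | p t) a t ^+ 2 by [].
rewrite [in RHS](partition_big Sx (fun S => S \subset [set: J]%SET))/=;
  last by move=> t _; rewrite finset.subsetT.
rewrite mulr_sumr; apply: eq_bigr => S _.
have [t /andP[pt /eqP tS]|none] := pickP (fun t => p t && (Sx t == S)).
  have one : (fun t' => p t' && (Sx t' == S)) =1 pred1 t.
    move=> t'; apply/andP/eqP => [[pt' /eqP t'S]|->]; last by rewrite tS.
    by apply: inj => //; rewrite t'S.
  by rewrite /c !(big_pred1 t one) -tS cardS.
by rewrite /c !big_pred0// expr0n/= !mulr0.
Qed.

End Rademacher.

(** * Bernoulli's inequality and power means *)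

Section PowerMean.
Variable R : realFieldType.

Lemma bernoulli (x : R) (s : nat) : 0 <= x -> 1 + s%:R * (x - 1) <= x ^+ s.
Proof.
move=> x0; elim: s => [|s IH]; first by rewrite mul0r addr0 expr0.
rewrite exprS; apply: le_trans (ler_wpM2l x0 IH).
rewrite -subr_ge0 -natr1.
have -> : x * (1 + s%:R * (x - 1)) - (1 + (s%:R + 1) * (x - 1)) = s%:R * (x - 1) ^+ 2.
  by ring.
by rewrite mulr_ge0// sqr_ge0.
Qed.

(** The power mean inequality without roots: Bernoulli's inequality at [u x / A], solved for [u x],
    is summed over [x], and the hypothesis makes the correction nonpositive. *)
Lemma sum_power_mean (E : finType) (s : nat) (u : E -> R) (A : R) :
  (0 < s)%N -> (forall x, 0 <= u x) -> 0 <= A ->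
  \sum_x u x ^+ s <= #|E|%:R * A ^+ s -> \sum_x u x <= #|E|%:R * A.
Proof.
move=> s0 u0 A0 h; have [A00|An0] := eqVneq A 0.
  rewrite A00 mulr0 big1// => x _; move: h.
  rewrite A00 expr0n eqn0Ngt s0 mulr0 => h.
  have /psumr_eq0P/(_ x isT)/eqP : \sum_x u x ^+ s = 0.
    by apply/eqP; rewrite eq_le h sumr_ge0// => y _; rewrite exprn_ge0.
  rewrite expf_eq0 s0 => /(_ (fun y _ => exprn_ge0 _ (u0 y))).
  by move=> /eqP.
have Ap : 0 < A by rewrite lt_def An0.
have sp : 0 < s%:R :> R by rewrite ltr0n.
have step x : u x <= A + (A / s%:R) * ((u x / A) ^+ s - 1).
  have := bernoulli s (divr_ge0 (u0 x) A0).
  rewrite -lerBrDl -(ler_pM2l (_ : 0 < A / s%:R)) ?divr_gt0//.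
  have -> : A / s%:R * (s%:R * (u x / A - 1)) = u x - A.
    by field; rewrite An0 gt_eqF.
  by rewrite lerBlDl.
apply: le_trans (ler_sum _ (fun x _ => step x)) _.
rewrite big_split/= sumr_const -[A *+ _]mulr_natl -[leRHS]addr0 lerD2l -mulr_sumr.
rewrite mulr_ge0_le0//; first by rewrite divr_ge0// ltW.
rewrite big_split/= sumr_const.
rewrite mulNrn subr_le0; under eq_bigr do rewrite expr_div_n.
by rewrite -mulr_suml ler_pdivrMr ?exprn_gt0.
Qed.

End PowerMean.

(** * Chaining for homogeneous Rademacher chaoses *)

Section Chaining.
Variables (R : realType) (J I : finType) (p : pred I) (Sx : I -> {set J}) (k : nat).
Hypothesis Sx_inj : {in p &, injective Sx}.
Hypothesis Sx_card : forall t, p t -> #|Sx t| = k.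
Implicit Types (a b : I -> R) (eps : {ffun J -> bool}).

Definition chaos a eps : R := \sum_(t | p t) a t * walsh R (Sx t) eps.
Definition sqsum a : R := \sum_(t | p t) a t ^+ 2.

Lemma chaosD a b eps : chaos (fun t => a t + b t) eps = chaos a eps + chaos b eps.
Proof. by rewrite /chaos -big_split/=; apply: eq_bigr => t _; rewrite mulrDl. Qed.

Lemma sqsum_ge0 a : 0 <= sqsum a.
Proof. by rewrite sumr_ge0// => t _; rewrite sqr_ge0. Qed.

Lemma chaos_norm_le a eps : `|chaos a eps| <= #|p|%:R * Num.sqrt (sqsum a).
Proof.
apply: le_trans (ler_norm_sum _ _ _) _.
rewrite -sum1_card natr_sum mulr_suml ler_sum// => t pt.
rewrite normrM walsh_norm mulr1 mul1r -sqrtr_sqr ler_wsqrtr//.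
by rewrite /sqsum (bigD1 t)//= lerDl sumr_ge0// => t' _; rewrite sqr_ge0.
Qed.

Lemma sqsum_link a b c v w : sqsum (fun t => a t - b t) <= v ->
  sqsum (fun t => a t - c t) <= w -> sqsum (fun t => b t - c t) <= 2 * (v + w).
Proof.
move=> hv hw; apply: (@le_trans _ _ (2 * (sqsum (fun t => a t - b t) + sqsum (fun t => a t - c t)))).
  rewrite /sqsum -big_split/= mulr_sumr ler_sum// => t _.
  rewrite -subr_ge0.
  have -> : 2 * ((a t - b t) ^+ 2 + (a t - c t) ^+ 2) - (b t - c t) ^+ 2 =
    (2 * a t - b t - c t) ^+ 2 by ring.
  exact: sqr_ge0.
by rewrite ler_pM2l// lerD.
Qed.

(* The moments are taken of order [2 m0 s] with [s] of the order of the log of the number of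
   chaoses, so that the union bound over these only costs a constant factor. *)
Lemma max_chaos_moment (m0 s : nat) (L : finType) (P : pred L) (a : L -> I -> R) (w : R) :
  (0 < m0)%N -> (0 < s)%N -> 0 <= w -> #|L|%:R <= expR 1 ^+ 2 ^+ s :> R ->
  (forall l, P l -> sqsum (a l) <= w) ->
  \sum_eps (\big[Order.max/0]_(l | P l) `|chaos (a l) eps|) ^+ m0.*2 <=
  #|{ffun J -> bool}|%:R *
  (Num.sqrt (expR 1 ^+ 2 * (m0.*2 * s)%:R ^+ k * w)) ^+ m0.*2.
Proof.
move=> m00 s0 w0 hL ha.
set M := fun eps => \big[Order.max/0]_(l | P l) `|chaos (a l) eps|.
have M0 eps : 0 <= M eps by exact: bigmax_ge_id.
have e1 : 1 <= expR 1 ^+ 2 :> R by rewrite exprn_ege1// ltW// expR_gt1.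
set D := expR 1 ^+ 2 in e1 hL *.
have D0 : 0 <= D by lra.
set q : R := (m0.*2 * s)%:R ^+ k * w.
have q0 : 0 <= q by rewrite mulr_ge0 ?exprn_ge0.
apply: (@sum_power_mean _ _ s) => //.
  by move=> eps; exact: (exprn_ge0 _ (M0 eps)).
have -> : Num.sqrt (D * (m0.*2 * s)%:R ^+ k * w) ^+ m0.*2 ^+ s = (D * q) ^+ (m0 * s).
  by rewrite -[D * _ * w]mulrA -/q -exprM -mul2n -mulnA exprM sqr_sqrtr// mulr_ge0.
have -> : #|{ffun J -> bool}|%:R * (D * q) ^+ (m0 * s) =
  (D ^+ (m0 * s)) * (#|{ffun J -> bool}|%:R * q ^+ (m0 * s)) :> R.
  by rewrite exprMn mulrCA.
have key l : P l -> \sum_eps `|chaos (a l) eps| ^+ (m0 * s).*2 <=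
    #|{ffun J -> bool}|%:R * q ^+ (m0 * s).
  move=> Pl; under eq_bigr do rewrite -mul2n exprM real_normK ?num_real// -exprM mul2n.
  apply: le_trans (chaos_moment _ _ Sx_inj Sx_card) _.
  rewrite ler_wpM2l// lerXn2r ?nnegrE//.
    by rewrite mulr_ge0 ?exprn_ge0// sqsum_ge0.
  by rewrite /q doubleMl ler_wpM2l ?exprn_ge0// ha.
apply: (@le_trans _ _ (\sum_(l | P l) \sum_eps `|chaos (a l) eps| ^+ (m0 * s).*2)).
  rewrite exchange_big/= ler_sum// => eps _; rewrite -exprM -doubleMl.
  have [l Pl|P0] := pickP P; last first.
    rewrite /M !big_pred0// expr0n/= double_eq0 muln_eq0 !eqn0Ngt m00 s0/=.
    exact: lexx.
  rewrite /M (bigmax_eq_arg _ l)//.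
  case: arg_maxP => // l' Pl' _.
  by rewrite [leRHS](bigD1 l')//= lerDl sumr_ge0// => l'' _; rewrite exprn_ge0.
apply: (le_trans (ler_sum _ key)).
rewrite sumr_const -[X in X <= _]mulr_natl ler_wpM2r//.
  by rewrite mulr_ge0 ?exprn_ge0.
(* The union bound costs the number of chaoses, at most [D ^ s], and the target has room for
   [D ^ (m0 * s)]. *)
apply: (@le_trans _ _ (#|L|%:R)); first by rewrite ler_nat max_card.
by apply: (le_trans hL); rewrite ler_weXn2l// leq_pmull.
Qed.

(** The bound [M] does not depend on [a]: it adds, over the levels, the maximum over all admissible
    links between neighbouring covers, and a deterministic bound for the distance from [a] to its
    last approximation. The chain starts at 0, the only centre of level 0. *)
Lemma chaining (m0 : nat) (T : set (I -> R)) (v : R) (L : nat) (N : nat -> nat)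
    (c : nat -> nat -> I -> R) :
  (0 < m0)%N -> 0 <= v ->
  N 0%N = 1%N -> c 0%N 0%N = (fun=> 0) -> {homo N : i j / (i <= j)%N} ->
  (forall l a, (l <= L)%N -> T a -> exists2 i, (i < N l)%N &
     sqsum (fun t => a t - c l i t) <= v / 4 ^+ l) ->
  exists M : {ffun J -> bool} -> R,
    (forall eps, 0 <= M eps) /\
    (forall a eps, T a -> `|chaos a eps| <= M eps) /\
    \sum_eps M eps ^+ m0.*2 <= #|{ffun J -> bool}|%:R *
      (Num.sqrt v * (Num.sqrt (10 * expR 1 ^+ 2 * m0.*2%:R ^+ k) *
         \sum_(l < L) (1 + ln (N l.+1)%:R) `^ (k%:R / 2) / 2 ^+ l.+1 +
         #|p|%:R / 2 ^+ L)) ^+ m0.*2.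
Proof.
move=> m00 v0 N0 c0 Nmono Tcov.
set B := Num.sqrt (10 * _ * _).
set h := fun l => (1 + ln (N l)%:R) `^ (k%:R / 2) : R.
have N1 l : (0 < N l)%N by rewrite -N0 Nmono.
(* Successive approximations of one [a] are at squared distance at most
   [2 (v / 4 ^ l.+1 + v / 4 ^ l)], that is [10 v / 4 ^ l.+1]; only such pairs count as links. *)
pose good l (ij : 'I_(N l.+1) * 'I_(N l)) :=
  sqsum (fun t => c l.+1 ij.1 t - c l ij.2 t) <= 10 * v / 4 ^+ l.+1.
pose W l eps := \big[Order.max/0]_(ij | good l ij)
  `|chaos (fun t => c l.+1 ij.1 t - c l ij.2 t) eps|.
have W0 l eps : 0 <= W l eps by exact: bigmax_ge_id.
have p4 l : 0 < 4 ^+ l :> R by rewrite exprn_gt0.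
have momW l : \sum_eps W l eps ^+ m0.*2 <= #|{ffun J -> bool}|%:R *
    (Num.sqrt v * (B * (h l.+1 / 2 ^+ l.+1))) ^+ m0.*2.
  have N1' : 1 <= (N l.+1)%:R :> R by rewrite ler1n.
  have lnN : 0 <= ln (N l.+1)%:R :> R by rewrite ln_ge0.
  (* There are at most [N l.+1 ^ 2] links, hence at most [e ^ (2 s)], while [s] stays below
     [1 + ln (N l.+1)], the quantity in the entropy integral. *)
  pose s := (Num.truncn (ln (N l.+1)%:R : R)).+1.
  have s_ge : ln (N l.+1)%:R <= s%:R :> R by rewrite ltW// truncnS_gt.
  have s_le : s%:R <= 1 + ln (N l.+1)%:R :> R.
    by rewrite /s -natr1 addrC lerD2l truncn_le.
  apply: le_trans (max_chaos_moment (s := s) (w := 10 * v / 4 ^+ l.+1) m00 _ _ _ _) _ => //.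
  - by rewrite divr_ge0 ?mulr_ge0// ltW.
  - rewrite card_prod !card_ord natrM -exprM mulnC exprM.
    apply: (@le_trans _ _ ((N l.+1)%:R ^+ 2)).
      by rewrite expr2 ler_wpM2l// ler_nat Nmono.
    rewrite lerXn2r ?nnegrE// ?exprn_ge0 ?expR_ge0//.
    rewrite -expRM_natl mulr1 -[leLHS](@lnK R) ?posrE ?ltr0n//.
    by rewrite ler_expR.
  - rewrite ler_wpM2l// lerXn2r ?nnegrE ?sqrtr_ge0//.
      by rewrite !mulr_ge0 ?sqrtr_ge0 ?powR_ge0 ?invr_ge0 ?exprn_ge0.
    have -> : expR 1 ^+ 2 * (m0.*2 * s)%:R ^+ k * (10 * v / 4 ^+ l.+1) =
       (10 * expR 1 ^+ 2 * m0.*2%:R ^+ k) * (s%:R ^+ k / 4 ^+ l.+1) * v :> R.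
      by rewrite natrM exprMn; field; rewrite gt_eqF.
    have A0 : 0 <= 10 * expR 1 ^+ 2 * m0.*2%:R ^+ k :> R.
      by rewrite !mulr_ge0 ?exprn_ge0 ?expR_ge0.
    have A1 : 0 <= s%:R ^+ k / 4 ^+ l.+1 :> R by rewrite divr_ge0 ?exprn_ge0 ?ltW.
    rewrite sqrtrM ?mulr_ge0// sqrtrM// mulrC ler_wpM2l ?sqrtr_ge0//.
    rewrite ler_wpM2l ?sqrtr_ge0//.
    have -> : h l.+1 / 2 ^+ l.+1 = Num.sqrt (((1 + ln (N l.+1)%:R) ^+ k) / 4 ^+ l.+1).
      have -> : (4 : R) = 2 ^+ 2 by rewrite -natrX.
      rewrite sqrtrM ?exprn_ge0 ?addr_ge0// sqrtrV ?exprn_ge0//.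
      rewrite -exprM mulnC exprM sqrtr_sqr ger0_norm ?exprn_ge0//.
      congr (_ / _); rewrite /h -powR12_sqrt ?exprn_ge0 ?addr_ge0//.
      by rewrite -powR_mulrn ?addr_ge0// -powRrM.
    rewrite ler_wsqrtr// ler_pM2r ?invr_gt0// lerXn2r ?nnegrE//.
    by rewrite addr_ge0.
pose M eps := \sum_(l < L) W l eps + Num.sqrt v * (#|p|%:R / 2 ^+ L).
exists M; split.
  by move=> eps; rewrite addr_ge0 ?sumr_ge0// mulr_ge0 ?sqrtr_ge0 ?divr_ge0 ?exprn_ge0.
split.
  move=> a eps Ta.
  have /choice [idx idxP] l : exists i, (l <= L)%N -> (i < N l)%N /\
      sqsum (fun t => a t - c l i t) <= v / 4 ^+ l.
    have [lL|lL] := leqP l L; last by exists 0%N.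
    by have [i iN hi] := Tcov l a lL Ta; exists i.
  have chain l : (l <= L)%N -> `|chaos (c l (idx l)) eps| <= \sum_(i < l) W i eps.
    elim: l => [_|l IH lL].
      rewrite big_ord0; have [] := idxP 0%N isT; rewrite N0 ltnS leqn0 => /eqP -> _.
      by rewrite c0 /chaos big1 ?normr0// => t _; rewrite mul0r.
    have [i1 s1] := idxP _ (ltnW lL); have [i2 s2] := idxP _ lL.
    have g : good l (Ordinal i2, Ordinal i1).
      apply: le_trans (sqsum_link s2 s1) _; rewrite exprS -subr_ge0.
      set x := 4 ^+ l.
      have -> : 10 * v / (4 * x) - 2 * (v / (4 * x) + v / x) = 0.
        by field; rewrite gt_eqF// /x.
      by [].
    have -> : c l.+1 (idx l.+1) = (fun t => (c l.+1 (idx l.+1) t - c l (idx l) t) + c l (idx l) t).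
      by apply/funext => t; rewrite subrK.
    rewrite chaosD big_ord_recr/= addrC; apply: le_trans (ler_normD _ _) _.
    apply: lerD; last exact: IH (ltnW lL).
    exact: (@Order.TotalTheory.bigmax_sup _ _ _ _ (Ordinal i2, Ordinal i1) _ _ _ g).
  have -> : a = (fun t => c L (idx L) t + (a t - c L (idx L) t)).
    by apply/funext => t; rewrite addrC subrK.
  rewrite chaosD; apply: le_trans (ler_normD _ _) _.
  apply: lerD; first exact: chain.
  apply: le_trans (chaos_norm_le _ _) _; rewrite mulrCA ler_wpM2l//.
  have [_ s1] := idxP _ (leqnn L).
  apply: le_trans (ler_wsqrtr s1) _.
  have -> : (4 : R) = 2 ^+ 2 by rewrite -natrX.
  rewrite sqrtrM// sqrtrV ?exprn_ge0// -exprM mulnC exprM sqrtr_sqr ger0_norm ?exprn_ge0//.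
rewrite mulrDr; apply: sum_expD_le => //.
- by move=> eps; rewrite sumr_ge0.
- rewrite !mulr_ge0 ?sqrtr_ge0// sumr_ge0// => l _.
  by rewrite divr_ge0 ?powR_ge0 ?exprn_ge0.
- elim: L {M Tcov} => [|L IH].
    under eq_bigr do rewrite big_ord0 expr0n/= double_eq0 eqn0Ngt m00/=.
    by rewrite big1// !mulr_ge0// ?exprn_ge0// ?mulr_ge0 ?sqrtr_ge0// big_ord0.
  under eq_bigr do rewrite big_ord_recr/=.
  rewrite big_ord_recr/= 2!mulrDr; apply: sum_expD_le => //.
  + by move=> eps; rewrite sumr_ge0.
  + rewrite !mulr_ge0 ?sqrtr_ge0// sumr_ge0// => l _.
    by rewrite divr_ge0 ?powR_ge0 ?exprn_ge0.
  + by rewrite !mulr_ge0 ?sqrtr_ge0 ?powR_ge0 ?invr_ge0 ?exprn_ge0.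
- by rewrite sumr_const -[X in X <= _]mulr_natl lexx.
Qed.

End Chaining.

(** * Comparison of integrals without measurability *)

Section LowerIntegral.
Local Open Scope ereal_scope.
Context d (T : measurableType d) (R : realType) (mu : {measure set T -> \bar R}).

(* No measurability is needed: the integral of a nonnegative function is a supremum over the
   simple functions below it. *)
Lemma ge0_le_integral_nomeas (D : set T) (f g : T -> \bar R) :
  (forall x, D x -> 0 <= f x) -> (forall x, D x -> f x <= g x) ->
  \int[mu]_(x in D) f x <= \int[mu]_(x in D) g x.
Proof.
move=> f0 fg; have g0 x : D x -> 0 <= g x by move=> Dx; apply: le_trans (f0 _ Dx) (fg _ Dx).
rewrite !ge0_integralE//; apply: ereal_sup_le => _ [h hf <-]; exists h => // x.
apply: le_trans (hf x) _; rewrite /patch; case: ifPn => //; rewrite inE; exact: fg.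
Qed.

End LowerIntegral.

(** * From the entropy integral to dyadic covers *)

Section EntropyIntegral.
Variable R : realType.
Local Notation mu := (@lebesgue_measure R).

(** By monotonicity [f] is at least [c l] on the dyadic interval that ends at [2 ^ -(l+1)], of
    length [2 ^ -(l+2)]. The step function with these values lies below [f], whose own measurability
    is unknown. *)
Lemma dyadic_steps_le_integral (f : R -> \bar R) (c : nat -> R) (L : nat) :
  (forall t : R, 0 <= t <= 1 -> (0 <= f t)%E) ->
  (forall s t : R, 0 < s -> s <= t -> t <= 1 -> (f t <= f s)%E) ->
  (forall l, (l < L)%N -> 0 <= c l /\ ((c l)%:E <= f (2^-1 ^+ l.+1)%R)%E) ->
  ((\sum_(l < L) c l * 2^-1 ^+ l.+2)%:E <=
   \int[mu]_(t in [set t : R | (0 <= t <= 1)%R]) f t)%E.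
Proof.
move=> f0 fmono hc.
pose A l : set R := `]2^-1 ^+ l.+2, 2^-1 ^+ l.+1]%classic.
have half0 n : 0 < (2^-1 : R) ^+ n by rewrite exprn_gt0.
have half1 n : (2^-1 : R) ^+ n <= 1 by rewrite exprn_ile1// invf_le1// ler1n.
have mA l : measurable (A l) by exact: measurable_itv.
have D01 : [set t : R | 0 <= t <= 1] = `[0, 1]%classic by apply/seteqP; split => t /=; rewrite in_itv.
have mD : measurable [set t : R | 0 <= t <= 1] by rewrite D01; exact: measurable_itv.
have AD l : A l `<=` [set t : R | 0 <= t <= 1].
  move=> t; rewrite /A/= in_itv/= => /andP[h1 h2].
  by rewrite (le_trans (ltW (half0 _)) (ltW h1))/= (le_trans h2).
have muA l : mu (A l) = (2^-1 ^+ l.+2)%:E.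
  rewrite /A lebesgue_measure_itv/= lte_fin ifT.
    rewrite -EFinB (_ : 2^-1 ^+ l.+1 = 2 * 2^-1 ^+ l.+2).
      by congr EFin; lra.
    by rewrite [in RHS]exprS mulrA divff ?mul1r.
  by rewrite [ltLHS]exprS gtr_pMl// invf_lt1// ltr1n.
have mI l : measurable_fun [set t : R | 0 <= t <= 1] (EFin \o (\1_(A l) : R -> R)).
  apply: measurable_funTS; apply/measurable_EFinP; exact: measurable_indic.
pose g (t : R) : \bar R := (\sum_(l < L) (c l)%:E * (\1_(A l) t)%:E)%E.
apply: (@le_trans _ _ (\int[mu]_(t in [set t : R | (0 <= t <= 1)%R]) g t)%E).
  rewrite ge0_integral_sum//; last 2 first.
  - move=> l; apply: emeasurable_funM => //.
    exact: mI.
  - by move=> l t _; rewrite mule_ge0// ?lee_fin//; have [] := hc l (ltn_ord l).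
  rewrite -sumEFin; apply: lee_sum => l _.
  rewrite ge0_integralZl_EFin//; last 2 first.
  - exact: mI.
  - by have [] := hc l (ltn_ord l).
  rewrite integral_indic; [|exact: mD|exact: mA].
  rewrite classical_sets.setIidl// EFinM -(muA l); exact: lexx.
apply: ge0_le_integral_nomeas.
  move=> t _; apply: sume_ge0 => l _; rewrite mule_ge0 ?lee_fin//.
  by have [] := hc l (ltn_ord l).
move=> t Dt; rewrite /g.
have [[l0 Al0]|none] := pselect (exists l0 : 'I_L, A l0 t); last first.
  rewrite big1; first exact: f0.
  move=> l _; rewrite indicE memNset ?mule0//.
  by move=> Al; apply: none; exists l.
rewrite (bigD1 l0)//= [X in (_ + X)%E]big1 ?adde0.
  rewrite indicE mem_set// mule1; have [_ h] := hc l0 (ltn_ord l0).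
  apply: (le_trans h); move: Al0; rewrite /A/= in_itv/= => /andP[h1 h2].
  by apply: fmono => //; exact: lt_trans h1.
move=> l ll0; rewrite indicE memNset ?mule0// => Al.
move: Al Al0; rewrite /A/= !in_itv/= => /andP[a1 a2] /andP[b1 b2].
have {ll0} : (l < l0)%N || (l0 < l)%N.
  by rewrite -neq_ltn; apply: contra ll0 => /eqP /val_inj ->.
have half_mono (i j : nat) : (i < j)%N -> (2^-1 : R) ^+ j.+1 <= 2^-1 ^+ i.+2.
  by move=> ij; rewrite ler_wiXn2l ?invr_ge0// invf_le1// ler1n.
case/orP => /half_mono h.
  by have := lt_le_trans a1 (le_trans b2 h); rewrite ltxx.
by have := lt_le_trans b1 (le_trans a2 h); rewrite ltxx.
Qed.

Section Levels.
Variables (D : Type) (k : nat) (T : set (D -> R)) (G : D -> R).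

Lemma Qnorm2_ge0 (Q : seq (D * R)) (g : D -> R) : 0 <= Qnorm2 Q g.
Proof. exact: sqrtr_ge0. Qed.

Lemma covers_le (Q : seq (D * R)) e e' n : e <= e' -> covers Q T e n -> covers Q T e' n.
Proof.
by move=> ee' [c hc]; exists c => g /hc[j hj]; exists j; apply: le_trans hj ee'.
Qed.

Lemma covers_gt0 (Q : seq (D * R)) e n : T !=set0 -> covers Q T e n -> (0 < n)%N.
Proof. by move=> [g Tg] [c] /(_ _ Tg)[j _]; apply: leq_ltn_trans (ltn_ord j). Qed.

Lemma ent_val_ge1 n : 1 <= (1 + ln n%:R) `^ (k%:R / 2) :> R.
Proof.
have ln0n : 0 <= ln n%:R :> R.
  (* The default [ln 0 = 0] covers the case of an empty cover. *)
  by case: n => [|n]; [rewrite ln0|rewrite ln_ge0// ler1n].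
rewrite -[leLHS](powRr0 (1 + ln n%:R)) ler_powR//.
by rewrite lerDl.
Qed.

Lemma ent_term_ge1 (Q : seq (D * R)) e : (1 <= ent_term k Q T e)%E.
Proof.
by apply: le_ereal_inf_tmp => _ [n _ <-]; rewrite lee_fin ent_val_ge1.
Qed.

Let entsup (t : R) : \bar R :=
  ereal_sup [set ent_term k Q T (t * Qnorm2 Q G) | Q in [set Q | fin_discrete_prob Q]].

Lemma ent_term_le (Q : seq (D * R)) e e' : e <= e' -> (ent_term k Q T e' <= ent_term k Q T e)%E.
Proof.
move=> ee'; apply: ereal_inf_le_tmp => _ [n hn <-]; exists n => //.
exact: covers_le hn.
Qed.

Lemma entsup_mono s t : s <= t -> (entsup t <= entsup s)%E.
Proof.
move=> st; apply: ge_ereal_sup => _ [Q hQ <-].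
apply: (@le_trans _ _ (ent_term k Q T (s * Qnorm2 Q G))).
  by apply: ent_term_le; rewrite ler_wpM2r// Qnorm2_ge0.
by apply: ereal_sup_ubound; exists Q.
Qed.

(** Lets an additive constant, such as the error of the last link of a chain, be absorbed into the
    entropy integral. *)
Lemma unif_entropy_integral_ge1 (Q : seq (D * R)) : fin_discrete_prob Q ->
  (1 <= unif_entropy_integral k T G 1)%E.
Proof.
move=> hQ; have D01 : [set t : R | 0 <= t <= 1] = `[0, 1]%classic.
  by apply/seteqP; split => t /=; rewrite in_itv.
apply: (@le_trans _ _ (\int[mu]_(t in [set t : R | (0 <= t <= 1)%R]) (cst 1%E) t)%E).
  have mu01 : mu `[0, 1]%classic = 1%E.
    by rewrite lebesgue_measure_itv/= lte_fin ltr01 oppr0 adde0.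
  rewrite D01 integral_cst; last exact: measurable_itv.
  rewrite mul1e -mu01; exact: lexx.
apply: ge0_le_integral_nomeas => // t _ /=.
apply: le_ereal_sup_tmp; exists (ent_term k Q T (t * Qnorm2 Q G)); last exact: ent_term_ge1.
by exists Q.
Qed.

(** Level 0 is the single centre 0, since [G] dominates [T] in [L^2(Q)]; level [l + 1] is a cover of
    minimal size at relative radius [2 ^ -(l+1)]. Minimality gives both the monotonicity of the
    sizes and their comparison with [ent_term]. *)
Lemma entropy_levels (Q : seq (D * R)) (J : R) :
  fin_discrete_prob Q -> T !=set0 -> unif_entropy_integral k T G 1 = J%:E ->
  (forall g, T g -> Qnorm2 Q g <= Qnorm2 Q G) ->
  exists (N : nat -> nat) (c : nat -> nat -> D -> R),
   [/\ N 0%N = 1%N, c 0%N 0%N = (fun=> 0), {homo N : i j / (i <= j)%N},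
      forall l g, T g -> exists2 i, (i < N l)%N &
         Qnorm2 Q (fun x => g x - c l i x) <= Qnorm2 Q G / 2 ^+ l &
      forall L, \sum_(l < L) (1 + ln (N l.+1)%:R) `^ (k%:R / 2) / 2 ^+ l.+1 <= 2 * J].
Proof.
move=> hQ T0 JE TG.
have half0 n : 0 < (2^-1 : R) ^+ n by rewrite exprn_gt0.
have half1 n : (2^-1 : R) ^+ n <= 1 by rewrite exprn_ile1// invf_le1// ler1n.
have sum_le c L : (forall l, (l < L)%N -> 0 <= c l /\ ((c l)%:E <= entsup (2^-1 ^+ l.+1)%R)%E) ->
    \sum_(l < L) c l * 2^-1 ^+ l.+2 <= J.
  move=> hc; rewrite -lee_fin -JE; apply: dyadic_steps_le_integral => //.
    move=> t _; apply: (@le_trans _ _ (ent_term k Q T (t * Qnorm2 Q G))).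
      by apply: le_trans (ent_term_ge1 _ _).
    by apply: ereal_sup_ubound; exists Q.
  by move=> s t _ st _; exact: entsup_mono.
have ent_le l : (ent_term k Q T (2^-1 ^+ l.+1 * Qnorm2 Q G)%R <= entsup (2^-1 ^+ l.+1)%R)%E.
  by apply: ereal_sup_ubound; exists Q.
(* Without a finite cover the entropy is [+oo] at this radius, and one step of height [z] under it
   already contributes [|J| + 1], more than the integral. *)
have cov l : exists n, covers Q T (2^-1 ^+ l.+1 * Qnorm2 Q G) n.
  apply: contrapT => none.
  have eoo : entsup (2^-1 ^+ l.+1) = +oo%E.
    apply/eqP; rewrite -leye_eq; apply: le_trans (ent_le l).
    apply: le_ereal_inf_tmp => _ [n hn <-]; exfalso; apply: none; by exists n.
  pose z := (`|J| + 1) / 2^-1 ^+ l.+2.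
  have J1 : 0 < `|J| + 1 by rewrite ltr_wpDl.
  have : \sum_(i < l.+1) (if (i : nat) == l then z else 0) * 2^-1 ^+ i.+2 <= J.
    apply: (sum_le (fun i => if i == l then z else 0)) => i _.
    case: eqP => [->|_]; first by rewrite eoo leey divr_ge0 ?ltW.
    by split => //; apply: le_trans (ent_le i); apply: le_trans (ent_term_ge1 _ _).
  rewrite big_ord_recr/= eqxx big1 ?add0r; last first.
    by move=> i _; rewrite (ltn_eqF (ltn_ord i)) mul0r.
  rewrite /z mulfVK ?gt_eqF// => h.
  have := le_trans h (ler_norm J); lra.
have covb l : exists n, `[< covers Q T (2^-1 ^+ l.+1 * Qnorm2 Q G) n >].
  by have [n hn] := cov l; exists n; apply/asboolP.
pose M l := ex_minn (covb l).
have MP l : covers Q T (2^-1 ^+ l.+1 * Qnorm2 Q G) (M l).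
  by rewrite /M; case: ex_minnP => n /asboolP.
have Mmin l n : covers Q T (2^-1 ^+ l.+1 * Qnorm2 Q G) n -> (M l <= n)%N.
  by rewrite /M; case: ex_minnP => m _ h /asboolP; exact: h.
have M1 l : (0 < M l)%N by exact: covers_gt0 (MP l).
have Mmono l : (M l <= M l.+1)%N.
  apply: Mmin; apply: covers_le (MP l.+1); rewrite ler_wpM2r ?Qnorm2_ge0//.
  by rewrite [leLHS]exprS ler_piMl ?(ltW (half0 _))// invf_le1// ler1n.
have /choice [cc ccP] l : exists c : nat -> D -> R, forall g, T g -> exists2 i, (i < M l)%N &
   Qnorm2 Q (fun x => g x - c i x) <= 2^-1 ^+ l.+1 * Qnorm2 Q G.
  have [c hc] := MP l.
  exists (fun i => if insub i is Some j then c j else fun=> 0) => g Tg.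
  by have [j hj] := hc g Tg; exists j => //; rewrite valK.
exists (fun l => if l is l'.+1 then M l' else 1%N).
exists (fun l => if l is l'.+1 then cc l' else fun _ _ => 0); split => //.
- apply: homo_leq => [//|x y z|]; first exact: leq_trans.
  by case=> [|l]; [exact: M1|exact: Mmono].
- move=> [|l] g Tg.
    exists 0%N => //; rewrite expr0 divr1.
    by apply: le_trans (TG g Tg); rewrite /Qnorm2; under eq_bigr do rewrite subr0.
  have [i iM hi] := ccP l g Tg; exists i => //.
  by rewrite mulrC -exprVn.
- move=> L; set h := fun l => (1 + ln (M l)%:R) `^ (k%:R / 2) : R.
  (* The radius at a level is twice the length of the dyadic interval that ends there; hence the
     factor 2. *)
  have -> : \sum_(l < L) h l / 2 ^+ l.+1 = 2 * \sum_(l < L) h l * 2^-1 ^+ l.+2.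
    rewrite mulr_sumr; apply: eq_bigr => l _.
    by rewrite [in RHS]exprS -exprVn; set x := 2^-1 ^+ l.+1; field.
  rewrite ler_pM2l//; apply: (sum_le h) => l _; split; first exact: powR_ge0.
  apply: le_trans (ent_le l); apply: le_ereal_inf_tmp => _ [n hn <-].
  have n1 := covers_gt0 T0 hn.
  rewrite lee_fin /h ge0_ler_powR ?nnegrE ?divr_ge0//.
  + by rewrite addr_ge0// ln_ge0// ler1n.
  + by rewrite addr_ge0// ln_ge0// ler1n.
  + by rewrite lerD2l ler_ln ?posrE ?ltr0n// ler_nat Mmin.
Qed.

End Levels.
End EntropyIntegral.

(** * Joint laws of finite independent families *)

Section ProductLaw.
Variables (R : realType) (T : finType).
Implicit Types (nu : T -> set R -> \bar R).

Definition joint {Om : Type} (X : T -> Om -> R) (w : Om) : #|{: T}|.-tuple R :=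
  [tuple X (enum_val j) w | j < #|{: T}|].

Lemma measurable_joint d (Om : measurableType d) (X : T -> Om -> R) :
  (forall t, measurable_fun setT (X t)) -> measurable_fun setT (joint X).
Proof.
move=> mX; apply/measurable_fun_tnthP => j.
rewrite (_ : _ \o _ = X (enum_val j)); first exact: mX.
by apply/funext => w /=; rewrite tnth_mktuple.
Qed.

(** Independence and marginals in one statement, tested on boxes. A deterministic coordinate fits
    in, with a Dirac mass as marginal. *)
Definition has_law d (Om : measurableType d) (P : set Om -> \bar R) (X : T -> Om -> R) nu :=
  (forall t, measurable_fun setT (X t)) /\
  forall B : T -> set R, (forall t, measurable (B t)) ->
    P [set w | forall t, B t (X t w)] = (\prod_t nu t (B t))%E.

Section UniqueLaw.
Context d1 d2 (Om1 : measurableType d1) (Om2 : measurableType d2).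
Variables (P1 : probability Om1 R) (P2 : {measure set Om2 -> \bar R}).
Variables (X1 : T -> Om1 -> R) (X2 : T -> Om2 -> R) (nu : T -> set R -> \bar R).
Hypotheses (h1 : has_law P1 X1 nu) (h2 : has_law P2 X2 nu).

Let mX1 : measurable_fun setT (joint X1). Proof. by apply: measurable_joint; case: h1. Qed.
Let mX2 : measurable_fun setT (joint X2). Proof. by apply: measurable_joint; case: h2. Qed.

Let mX1_mixin := isMeasurableFun.Build _ _ _ _ _ mX1.
Let mX1_pack : {mfun _ >-> _} := HB.pack (joint X1) mX1_mixin.
Let mX2_mixin := isMeasurableFun.Build _ _ _ _ _ mX2.
Let mX2_pack : {mfun _ >-> _} := HB.pack (joint X2) mX2_mixin.

(** The boxes are stable under intersection and generate the sigma-algebra of the tuples, so they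
    determine the law. *)
Lemma has_law_unique (A : set (#|{: T}|.-tuple R)) : measurable A ->
  pushforward P1 (joint X1) A = pushforward P2 (joint X2) A.
Proof.
pose box (B : T -> set R) : set (#|{: T}|.-tuple R) :=
  [set x | forall t, B t (tnth x (enum_rank t))].
pose G := [set box B | B in [set B : T -> set R | forall t, measurable (B t)]].
have boxT : box (fun=> setT) = setT by apply/seteqP; split.
have preim (Om : Type) (X : T -> Om -> R) B :
    joint X @^-1` box B = [set w | forall t, B t (X t w)].
  apply/seteqP; split => w /= h t; first by have := h t; rewrite tnth_mktuple enum_rankK.
  by rewrite tnth_mktuple enum_rankK.
move=> mA.
apply: (measure_unique G (fun=> setT) _ _ _ _ (pushforward P1 mX1_pack) (pushforward P2 mX2_pack)) => //.
- apply/seteqP; split; last first.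
    apply: smallest_sub; first exact: sigma_algebra_measurable.
    move=> _ [B mB <-].
    have -> : box B = \bigcap_(t in [set: T]) (@tnth _ R ^~ (enum_rank t)) @^-1` (B t).
      by apply/seteqP; split => x /= h t; [move=> _|]; apply: h.
    apply: fin_bigcap_measurable => // t _.
    by rewrite -[X in measurable X]setTI; apply: measurable_tnth.
  apply: smallest_sub; first exact: smallest_sigma_algebra.
  rewrite -bigcup_seq/=; apply: bigcup_sub => i _ _ [B mB <-].
  apply: sub_sigma_algebra; exists (fun t => if enum_rank t == i then B else setT).
    by move=> t; case: ifP.
  rewrite setTI; apply/seteqP; split => x /=.
    by move=> /(_ (enum_val i)); rewrite enum_valK eqxx.
  by move=> Bx t; case: eqP => // ->.
- move=> _ _ [B mB <-] [C mC <-]; exists (fun t => B t `&` C t).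
    by move=> t; apply: measurableI.
  apply/seteqP; split => x /=; first by move=> h; split => t; have [] := h t.
  by move=> [hB hC] t; split.
- by move=> _; exists (fun=> setT).
- by apply/seteqP; split => // x _; exists 0%N.
- move=> _ [B mB <-]; rewrite /= /pushforward/= !preim.
  by rewrite (proj2 h1 _ mB) (proj2 h2 _ mB).
- by move=> _; rewrite /= /pushforward preimage_setT probability_setT ltry.
Qed.

Local Open Scope ereal_scope.

Lemma has_law_integral (phi : #|{: T}|.-tuple R -> \bar R) :
  measurable_fun setT phi -> (forall x, 0 <= phi x) ->
  \int[P1]_w phi (joint X1 w) = \int[P2]_w phi (joint X2 w).
Proof.
move=> mphi phi0.
have /= := ge0_integral_pushforward mX1 P1 measurableT mphi (fun y _ => phi0 y).
have /= := ge0_integral_pushforward mX2 P2 measurableT mphi (fun y _ => phi0 y).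
rewrite !preimage_setT => <- <-.
apply: (@eq_measure_integral _ _ _ _ (pushforward P2 mX2_pack) (pushforward P1 mX1_pack)).
by move=> A mA _; apply: has_law_unique.
Qed.

Lemma has_law_integrable (phi : #|{: T}|.-tuple R -> \bar R) :
  measurable_fun setT phi -> P1.-integrable setT (phi \o joint X1) ->
  P2.-integrable setT (phi \o joint X2).
Proof.
move=> mphi /integrableP[_ h]; apply/integrableP; split; first exact: (measurableT_comp mphi mX2).
apply: le_lt_trans h; rewrite [leRHS](@has_law_integral (abse \o phi))//.
- by apply: measurableT_comp.
- by move=> x; exact: abse_ge0.
Qed.

Lemma has_law_integral_signed (phi : #|{: T}|.-tuple R -> \bar R) :
  measurable_fun setT phi -> 
  \int[P1]_w phi (joint X1 w) = \int[P2]_w phi (joint X2 w).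
Proof.
move=> mphi; rewrite [LHS]integralE [RHS]integralE.
have -> : (fun w => phi (joint X1 w))^\+ = phi^\+ \o joint X1 by rewrite -funepos_comp.
have -> : (fun w => phi (joint X2 w))^\+ = phi^\+ \o joint X2 by rewrite -funepos_comp.
have -> : (fun w => phi (joint X1 w))^\- = phi^\- \o joint X1 by rewrite -funeneg_comp.
have -> : (fun w => phi (joint X2 w))^\- = phi^\- \o joint X2 by rewrite -funeneg_comp.
by rewrite !(has_law_integral (phi := _))//; [exact: measurable_funeneg|exact: measurable_funepos].
Qed.

End UniqueLaw.

Section Mixture.
Context d1 d2 (Om1 : measurableType d1) (Om2 : measurableType d2).
Variables (P1 : probability Om1 R) (P2 : probability Om2 R).
Variables (nu : T -> set R -> \bar R) (W : pred T).

(** The invariance behind resampling. Each coordinate is read from one factor only, so a box for the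
    mixture is the product of two boxes that are [setT] in the coordinates not read there. *)
Lemma has_law_mixture (X1 : T -> Om1 -> R) (X2 : T -> Om2 -> R) :
  has_law P1 X1 nu -> has_law P2 X2 nu -> (forall t, nu t setT = 1%E) ->
  has_law (P1 \x P2)%E (fun t z => if W t then X2 t z.2 else X1 t z.1) nu.
Proof.
move=> [mX1 h1] [mX2 h2] nuT; split.
  by move=> t; case: (W t); apply: measurableT_comp.
move=> B mB.
pose B1 t := if W t then setT else B t; pose B2 t := if W t then B t else setT.
have mB1 t : measurable (B1 t) by rewrite /B1; case: (W t).
have mB2 t : measurable (B2 t) by rewrite /B2; case: (W t).
have mE (d : measure_display) (Om : measurableType d) (X : T -> Om -> R) (C : T -> set R) :
    (forall t, measurable_fun setT (X t)) -> (forall t, measurable (C t)) ->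
    measurable [set w | forall t, C t (X t w)].
  move=> mX mC.
  have -> : [set w | forall t, C t (X t w)] = \bigcap_(t in [set: T]) X t @^-1` C t.
    by apply/seteqP; split => w /= h t; [move=> _|]; apply: h.
  apply: fin_bigcap_measurable => // t _.
  by rewrite -[X in measurable X]setTI; apply: mX.
have -> : [set w : Om1 * Om2 | forall t, B t (if W t then X2 t w.2 else X1 t w.1)] =
    [set w | forall t, B1 t (X1 t w)] `*` [set w | forall t, B2 t (X2 t w)].
  apply/seteqP; split => [[w1 w2]/= h|[w1 w2]/= [g1 g2] t].
    by split => t; rewrite /B1 /B2; have := h t; case: (W t).
  by have := g1 t; have := g2 t; rewrite /B1 /B2; case: (W t).
transitivity (P1 [set w | forall t, B1 t (X1 t w)] * P2 [set w | forall t, B2 t (X2 t w)])%E.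
  by apply: product_measure1E; exact: mE.
rewrite (h1 _ mB1) (h2 _ mB2) -big_split/=; apply: eq_bigr => t _.
by rewrite /B1 /B2; case: (W t); rewrite nuT ?mul1e ?mule1.
Qed.

End Mixture.

End ProductLaw.

(** * Weak forms of Jensen's inequality for real powers *)

Section PowerInequalities.
Variable R : realType.

(** Beyond [b] one has [x = x ^ (1 - q) * x ^ q], and [x ^ (1 - q)] is at most [b ^ (1 - q)]. Being
    linear in [x] and [x ^ q], the bound can be averaged. *)
Lemma le_add_powR (q x b : R) : 1 <= q -> 0 <= x -> 0 < b ->
  x <= b + b `^ (1 - q) * x `^ q.
Proof.
move=> q1 x0 b0; have [xb|bx] := leP x b.
  by rewrite (le_trans xb)// lerDl mulr_ge0// powR_ge0.
apply: (@le_trans _ _ (b `^ (1 - q) * x `^ q)); last by rewrite lerDr ltW.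
have -> : x `^ q = x `^ (q - 1) * x.
  rewrite -[X in _ * X](powRr1 x0) -powRD ?subrK//.
  by apply/implyP => _; rewrite gt_eqF// (lt_trans b0).
rewrite mulrA ler_peMl// -[leLHS](powRr0 b).
apply: (@le_trans _ _ (b `^ (1 - q) * b `^ (q - 1))).
  rewrite -powRD; last by apply/implyP => _; rewrite gt_eqF.
  by rewrite addrA subrK subrr.
by rewrite ler_wpM2l ?powR_ge0// ge0_ler_powR ?nnegrE ?subr_ge0 ?(ltW bx) ?(ltW b0).
Qed.

(* Applied to a mean [a] of nonnegative numbers and the mean [b] of their [q]-th powers, this is
   Jensen's inequality up to the factor [2 `^ q]. *)
Lemma powR_le_of_split (q a b : R) : 1 <= q -> 0 <= a -> 0 <= b ->
  (forall c, 0 < c -> a <= c + c `^ (1 - q) * b) -> a `^ q <= 2 `^ q * b.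
Proof.
move=> q1 a0 b0 h.
have q0 : 0 < q by lra.
have [b00|bn0] := eqVneq b 0.
  have a00 : a = 0.
    apply/eqP; rewrite eq_le a0 andbT; apply/ler_addgt0Pr => e e0.
    by have := h e e0; rewrite b00 mulr0 addr0 add0r.
  by rewrite a00 b00 mulr0 powR0 ?gt_eqF.
have bp : 0 < b by rewrite lt_def bn0.
(* This value of [c] makes the two terms equal, so the bound becomes [2 c]. *)
have := h (b `^ q^-1) (powR_gt0 _ bp).
have -> : b `^ q^-1 `^ (1 - q) * b = b `^ q^-1.
  rewrite -[X in _ * X](powRr1 b0) -powRrM -powRD; last by apply/implyP => _.
  by congr (_ `^ _); field; rewrite gt_eqF.
rewrite -mulr2n -[X in a <= X -> _]mulr_natl => h'.
apply: (@le_trans _ _ ((2 * b `^ q^-1) `^ q)).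
  by apply: ge0_ler_powR; rewrite ?nnegrE ?(ltW q0) ?mulr_ge0 ?powR_ge0.
by rewrite powRM ?powR_ge0// -powRrM mulVf ?gt_eqF// powRr1.
Qed.

Lemma average_powR_le (I : finType) (p : pred I) (n q : R) (y : I -> R) :
  1 <= q -> 0 < n -> n = #|p|%:R -> (forall t, p t -> 0 <= y t) ->
  (n^-1 * \sum_(t | p t) y t) `^ q <= 2 `^ q * (n^-1 * \sum_(t | p t) y t `^ q).
Proof.
move=> q1 n0 nE y0; apply: powR_le_of_split => //.
- by rewrite mulr_ge0 ?invr_ge0 ?(ltW n0)// sumr_ge0.
- by rewrite mulr_ge0 ?invr_ge0 ?(ltW n0)// sumr_ge0// => t _; rewrite powR_ge0.
move=> c c0.
rewrite mulrCA -[X in X + _](_ : n^-1 * (n * c) = c); last by rewrite mulrA mulVf ?mul1r ?gt_eqF.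
rewrite -mulrDr ler_wpM2l ?invr_ge0 ?(ltW n0)//.
rewrite mulr_sumr nE mulr_natl -sumr_const -big_split/= ler_sum// => t pt.
exact: le_add_powR (y0 t pt) c0.
Qed.

Lemma integral_powR_le d (T : measurableType d) (P : probability T R) (q : R) (h : T -> R) :
  1 <= q -> P.-integrable setT (EFin \o h) ->
  ((`|fine (\int[P]_w (h w)%:E)| `^ q)%:E <= (2 `^ q)%:E * \int[P]_w (`|h w| `^ q)%:E)%E.
Proof.
move=> q1 ih; have mh : measurable_fun setT h.
  by apply/measurable_EFinP; exact: measurable_int ih.
have mhq : measurable_fun setT (fun w => (`|h w| `^ q)%:E).
  apply/measurable_EFinP; apply: (measurableT_comp (measurable_powR q)).
  exact: measurableT_comp.
set b := (\int[P]_w (`|h w| `^ q)%:E)%E.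
have b0 : (0 <= b)%E by apply: integral_ge0 => w _; rewrite lee_fin powR_ge0.
have [bfin|] := boolP (b \is a fin_num); last first.
  rewrite ge0_fin_numE// -leNgt leye_eq => /eqP ->.
  by rewrite gt0_muley ?leey// lte_fin powR_gt0.
rewrite -(fineK bfin) -EFinM lee_fin; apply: powR_le_of_split => //.
  by rewrite fine_ge0.
move=> c c0.
have fi := integrable_fin_num measurableT ih.
rewrite -lee_fin EFinD EFinM fineK// -abse_EFin fineK//.
apply: le_trans (le_abse_integral _ measurableT (measurable_int _ ih)) _.
rewrite -ge0_integralZl_EFin// ?powR_ge0//.
rewrite -[X in (X + _)%E](_ : \int[P]_w (cst c%:E) w = c%:E)%E; last first.
  by rewrite integral_cst// -[RHS]mule1; congr (_ * _)%E; exact: probability_setT.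
rewrite -ge0_integralD//; last 3 first.
- by move=> w _; rewrite lee_fin ltW.
- by move=> w _; rewrite mule_ge0// lee_fin powR_ge0.
- exact: emeasurable_funM.
apply: ge0_le_integral => //.
- by apply: measurableT_comp => //; exact: measurable_int ih.
- by apply: emeasurable_funD => //; apply: emeasurable_funM.
move=> w _ /=; rewrite lee_fin; exact: le_add_powR.
Qed.

End PowerInequalities.

(** * Conditioning on a part of the array and the tower property *)

Section Model.
Context {R : realType} {K : nat} {d : measure_display} {S : measurableType d}
        {dO : measure_display} {Om : measurableType dO}.
Variables (P : probability Om R) (U : idx K -> Om -> R) (tau : famT R K -> S).
Hypothesis K_gt0 : (0 < K)%N.
Hypothesis iidU : iid P [set v : idx K | v != zero_idx K] U.
Hypothesis mtau : measurable_fun setT tau.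

Local Notation one := (one_idx K).
Local Notation zero := (zero_idx K).

Lemma one_neq0 : one != zero.
Proof. by apply/eqP => /ffunP /(_ (Ordinal K_gt0)); rewrite !ffunE. Qed.

Lemma odot_neq0 (i : idx K) (C : sub K) : (forall j, (0 < i j)%N) -> C != finset.set0 ->
  odot i C != zero.
Proof.
move=> i0 /finset.set0Pn[j jC]; apply/eqP => /ffunP /(_ j); rewrite !ffunE jC.
by have := i0 j; case: (i j).
Qed.

Lemma odot_inj (i : idx K) : (forall j, (0 < i j)%N) -> injective (odot i).
Proof.
move=> i0 C C' /ffunP h; apply/setP => j; have := h j; rewrite !ffunE.
by have := i0 j; case: (j \in C); case: (j \in C'); case: (i j).
Qed.

Lemma measurable_U (v : idx K) : v != zero -> measurable_fun setT (U v).
Proof. by move=> v0; case: iidU => + _ _; exact. Qed.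

Definition marg (B : set R) : \bar R := P (U one @^-1` B).

Lemma margE v B : v != zero -> measurable B -> P (U v @^-1` B) = marg B.
Proof. by move=> v0 mB; case: iidU => _ _; apply => //; exact: one_neq0. Qed.

Section Frozen.
Variables (T : finType) (F : pred T) (c : T -> R) (v : T -> idx K).
Hypothesis v0 : forall t, ~~ F t -> v t != zero.
Hypothesis vinj : {in predC F &, injective v}.

(** Conditioning on some of the [U]'s is expressed by holding them at constants. *)
Definition frozen (t : T) (w : Om) : R := if F t then c t else U (v t) w.
Definition frozen_law (t : T) : set R -> \bar R := if F t then \d_(c t) else marg.

Lemma frozen_lawT t : frozen_law t setT = 1%E.
Proof.
rewrite /frozen_law; case: ifP => _; first by rewrite diracT.
by rewrite /marg preimage_setT probability_setT.
Qed.

Lemma has_law_frozen : has_law P frozen frozen_law.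
Proof.
split=> [t|B mB].
  rewrite /frozen; case: (boolP (F t)) => Ft; first exact: measurable_cst.
  exact: measurable_U (v0 Ft).
have [bad|good] := pselect (exists t, F t /\ ~ B t (c t)).
  have [t [Ft Bt]] := bad.
  rewrite (_ : [set w | _] = set0) ?measure0; last first.
    by apply/seteqP; split => // w /(_ t); rewrite /frozen Ft.
  rewrite (bigD1 t)//= /frozen_law Ft diracE memNset// mul0e//.
pose s := [seq v t | t <- index_enum T & ~~ F t].
have us : uniq s.
  rewrite map_inj_in_uniq ?filter_uniq ?index_enum_uniq// => t t'.
  by rewrite !mem_filter => /andP[? _] /andP[? _]; apply: vinj; rewrite inE.
have sD i : i \in s -> i != zero.
  by move=> /mapP[t]; rewrite mem_filter => /andP[Ft _] ->; exact: v0.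
(* The box is carried from [T] to the indices of the array; injectivity of [v] off [F] makes the
   value at [v t] unambiguous. *)
pose B' i := if [pick t | ~~ F t && (v t == i)] is Some t then B t else setT.
have B'E t : ~~ F t -> B' (v t) = B t.
  move=> Ft; rewrite /B'; case: pickP => [t' /andP[Ft' /eqP vt']|/(_ t)].
    by rewrite (vinj _ _ vt')// inE.
  by rewrite Ft eqxx.
have mB' i : measurable (B' i) by rewrite /B'; case: pickP.
case: iidU => _ indep _.
have := indep s B' us sD mB'.
rewrite (_ : \bigcap_(i in _) _ = [set w | forall t, B t (frozen t w)]); last first.
  apply/seteqP; split => w /= h.
    move=> t; rewrite /frozen; case: (boolP (F t)) => Ft.
      by apply: contrapT => nB; apply: good; exists t.
    rewrite -B'E//; apply: h; rewrite /=; apply/mapP; exists t => //.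
    by rewrite mem_filter Ft mem_index_enum.
  move=> i /= /mapP[t]; rewrite mem_filter => /andP[Ft _] ->.
  by rewrite /preimage/= B'E//; have := h t; rewrite /frozen (negbTE Ft).
move=> ->; rewrite big_map big_filter [RHS](bigID F)/=.
rewrite [X in (_ = X * _)%E]big1 ?mul1e; last first.
  move=> t Ft; rewrite /frozen_law Ft diracE mem_set//.
  by apply: contrapT => nB; apply: good; exists t.
by apply: eq_bigr => t Ft; rewrite B'E// margE ?v0// /frozen_law (negbTE Ft).
Qed.

End Frozen.

(** The random point whose image under [f] is integrated in [Pe]. *)
Definition Sfill (A : sub K) (u : sub K -> R) (w : Om) : S :=
  tau (tau_in (fun B => if B \subset A then u B else U (odot one B) w)).

Lemma PeE (f : S -> R) A u : Pe P U tau f A u = fine (\int[P]_w (f (Sfill A u w))%:E)%E.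
Proof. by []. Qed.

Lemma tau_in_ext (u u' : sub K -> R) : (forall C : sub K, C != finset.set0 -> u C = u' C) ->
  tau_in u = tau_in u'.
Proof.
move=> h; apply: eq_from_tnth => j; rewrite !tnth_mktuple.
by case: ifPn => // C0; apply: h; rewrite -cards_eq0.
Qed.

Lemma Sfill_ext (A : sub K) (u u' : sub K -> R) w :
  (forall C : sub K, C \subset A -> C != finset.set0 -> u C = u' C) ->
  Sfill A u w = Sfill A u' w.
Proof.
by move=> h; congr tau; apply: tau_in_ext => C C0; case: ifPn => // CA; exact: h.
Qed.

Lemma Pe_ext f (A : sub K) (u u' : sub K -> R) :
  (forall C : sub K, C \subset A -> C != finset.set0 -> u C = u' C) ->
  Pe P U tau f A u = Pe P U tau f A u'.
Proof.
by move=> h; rewrite !PeE; congr fine; apply: eq_integral => w _; rewrite (Sfill_ext _ h).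
Qed.

Lemma measurable_tau d' (Z : measurableType d') (g : sub K -> Z -> R) :
  (forall C : sub K, C != finset.set0 -> measurable_fun setT (g C)) ->
  measurable_fun setT (fun z => tau (tau_in (fun C => g C z))).
Proof.
move=> mg; apply: (measurableT_comp mtau); apply/measurable_fun_tnthP => j.
rewrite (_ : _ \o _ = fun z => if #|enum_val j| == 0%N then 0 else g (enum_val j) z).
  by case: (boolP (#|enum_val j| == 0%N)) => // C0; apply: mg; rewrite -cards_eq0.
by apply/funext => z /=; rewrite tnth_mktuple.
Qed.

Lemma measurable_Sfill d' (Z : measurableType d') (A : sub K) (u : Z -> sub K -> R) :
  (forall C : sub K, C \subset A -> C != finset.set0 -> measurable_fun setT (u^~ C)) ->
  measurable_fun setT (fun z : Z * Om => Sfill A (u z.1) z.2).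
Proof.
move=> mu; apply: (measurable_tau (g := fun C z => if C \subset A then u z.1 C else U (odot one C) z.2)).
move=> C C0; case: (boolP (C \subset A)) => CA.
  exact: (measurableT_comp (mu C CA C0) measurable_fst).
apply: (measurableT_comp (measurable_U _) measurable_snd).
by apply: odot_neq0 => // j; rewrite ffunE.
Qed.

Lemma measurable_Sfill_fixed (A : sub K) (u : sub K -> R) : measurable_fun setT (Sfill A u).
Proof.
apply: (measurable_tau (g := fun C w => if C \subset A then u C else U (odot one C) w)).
move=> C C0; case: (C \subset A); first exact: measurable_cst.
by apply: measurable_U; apply: odot_neq0 => // j; rewrite ffunE.
Qed.

(* The tower property of the conditional expectations given the [U]'s below [A] and below [B]. *)
Section Swap.
Variables (A B : sub K) (i : idx K) (u : sub K -> R).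
Hypothesis i_gt0 : forall j, (0 < i j)%N.
Hypothesis BA : B \subset A.

Definition refill (w : Om) : sub K -> R := fun C => if C \subset B then u C else U (odot i C) w.

Let F (C : sub K) := (C == finset.set0) || (C \subset B).
Let c (C : sub K) := if C == finset.set0 then 0 else u C.

Let nF C : ~~ F C -> C != finset.set0. Proof. by rewrite /F negb_or => /andP[]. Qed.

Let law1 : has_law P (frozen F c (odot i)) (frozen_law F c).
Proof.
apply: has_law_frozen => [C /nF C0|C C' _ _]; first exact: odot_neq0.
exact: odot_inj.
Qed.

Let law2 : has_law P (frozen F c (odot one)) (frozen_law F c).
Proof.
have one0 j : (0 < one j)%N by rewrite ffunE.
apply: has_law_frozen => [C /nF C0|C C' _ _]; first exact: odot_neq0.
exact: odot_inj.
Qed.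

Let law12 := has_law_mixture (fun C : sub K => ~~ (C \subset A)) law1 law2 (frozen_lawT F c).

Let jointB w : tau (joint (frozen F c (odot one)) w) = Sfill B u w.
Proof.
congr tau; apply: eq_from_tnth => j; rewrite !tnth_mktuple /frozen /F /c cards_eq0.
by case: eqP => //= _; case: ifP.
Qed.

Let jointA (z : Om * Om) :
  tau (joint (fun (C : sub K) z => if ~~ (C \subset A) then frozen F c (odot one) C z.2
                         else frozen F c (odot i) C z.1) z) = Sfill A (refill z.1) z.2.
Proof.
congr tau; apply: eq_from_tnth => j; rewrite !tnth_mktuple /frozen /F /c /refill cards_eq0.
case: eqP => //= [_|_]; first by rewrite if_same.
case: (boolP (enum_val j \subset A)) => //= CA.
by case: ifP => // CB; rewrite (fintype.subset_trans CB BA) in CA.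
Qed.

Let mrefill (C : sub K) : C \subset A -> C != finset.set0 -> measurable_fun setT (refill^~ C).
Proof.
move=> _ C0; rewrite /refill; case: (C \subset B); first exact: measurable_cst.
by apply: measurable_U; apply: odot_neq0.
Qed.

Local Open Scope ereal_scope.

(** Both sides integrate against one law, in which the entries below [B] are frozen at [u]. On the
    left the other entries come from two independent copies: those below [A] from the outer one, at
    the index [i], the remaining ones from the inner one, at the index [one]. Tonelli's theorem
    iterates the integral. *)
Lemma integral_refill (phi : S -> \bar R) : measurable_fun setT phi -> (forall x, 0 <= phi x) ->
  \int[P]_w \int[P]_w' phi (Sfill A (refill w) w') = \int[P]_w phi (Sfill B u w).
Proof.
move=> mphi phi0.
have := has_law_integral law2 law12 (measurableT_comp mphi mtau) (fun x => phi0 _).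
rewrite (eq_integral (fun w => phi (Sfill B u w))) => [|w _]; last first.
  by rewrite -jointB.
move=> ->.
rewrite (eq_integral (fun z => phi (Sfill A (refill z.1) z.2))) => [|z _]; last first.
  by rewrite -jointA.
rewrite [RHS]fubini_tonelli1//=.
exact: (measurableT_comp mphi (measurable_Sfill mrefill)).
Qed.

Lemma integral_refill_signed (f : S -> R) : measurable_fun setT f ->
  P.-integrable setT (fun w => (f (Sfill B u w))%:E) ->
  P.-integrable setT (fun w => (Pe P U tau f A (refill w))%:E) /\
  \int[P]_w (Pe P U tau f A (refill w))%:E = (Pe P U tau f B u)%:E.
Proof.
move=> mf intf.
have mEf : measurable_fun setT (EFin \o f) by exact/measurable_EFinP.
have mEft := measurableT_comp mEf mtau.
have int2 : (P \x P).-integrable setT (fun z => (f (Sfill A (refill z.1) z.2))%:E).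
  have := has_law_integrable law2 law12 mEft.
  rewrite (_ : _ \o joint _ = fun w => (f (Sfill B u w))%:E); last first.
    by apply/funext => w /=; rewrite jointB.
  move=> /(_ intf); rewrite (_ : _ \o joint _ = fun z => (f (Sfill A (refill z.1) z.2))%:E)//.
  by apply/funext => z /=; rewrite jointA.
have intF := integrable_fubini_F int2.
(* Since [Pe] applies [fine], it agrees with the inner integral only where the latter is finite,
   hence almost everywhere. *)
have aeF : ae_eq P setT (fubini_F P (fun z => (f (Sfill A (refill z.1) z.2))%:E))
    (fun w => (Pe P U tau f A (refill w))%:E).
  have := integrable_ae measurableT intF; apply: filterS => w /= h _.
  by rewrite PeE fineK//; exact: h.
have mPe : measurable_fun setT (fun w => (Pe P U tau f A (refill w))%:E).
  have := measurable_fubini_F int2 => mF.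
  apply/measurable_EFinP.
  exact: (measurableT_comp (fine_measurable measurableT) mF).
split.
  apply/integrableP; split => //; have /integrableP[mF hF] := intF.
  apply: le_lt_trans hF; rewrite le_eqVlt; apply/orP; left; apply/eqP.
  apply: ae_eq_integral => //.
  - exact: measurableT_comp.
  - exact: measurableT_comp.
  - by apply: filterS aeF => w h _; rewrite -h.
apply: etrans; first by apply/esym; apply: ae_eq_integral aeF => //; exact: measurable_fubini_F int2.
rewrite integral12_prod_meas1// PeE fineK; last exact: integrable_fin_num.
have := has_law_integral_signed law2 law12 mEft.
rewrite (eq_integral (fun w => (f (Sfill B u w))%:E)) => [->|w _]; last first.
  by rewrite -jointB.
by apply: eq_integral => z _; rewrite -jointA.
Qed.

End Swap.
End Model.

(** * Resampling a finite part of the array *)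

Section Array.
Context {R : realType} {K : nat} {d : measure_display} {S : measurableType d}
        {dO : measure_display} {Om : measurableType dO}.
Variables (P : probability Om R) (U : idx K -> Om -> R) (tau : famT R K -> S).
Hypothesis K_gt0 : (0 < K)%N.
Hypothesis iidU : iid P [set v : idx K | v != zero_idx K] U.
Hypothesis mtau : measurable_fun setT tau.
Variable m : nat.

(** A finite set of indices turns the relevant part of the array into a tuple. The value 0 is
    included because [odot] produces it. *)
Definition bounded_idx := {ffun 'I_K -> 'I_m.+1}.
Definition idx_of_bounded (v : bounded_idx) : idx K := [ffun j => (v j : nat)].
Definition bounded_of_idx (i : idx K) : bounded_idx := [ffun j => inord (i j)].
Definition admissible (i : idx K) := forall j, (0 < i j <= m)%N.

Lemma bounded_of_idxK (i : idx K) : (forall j, (i j <= m)%N) -> idx_of_bounded (bounded_of_idx i) = i.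
Proof. by move=> im; apply/ffunP => j; rewrite !ffunE inordK// ltnS. Qed.

Lemma idx_of_bounded_inj : injective idx_of_bounded.
Proof. by move=> v v' /ffunP h; apply/ffunP => j; apply/val_inj; have := h j; rewrite !ffunE. Qed.

Definition is_zero (v : bounded_idx) := idx_of_bounded v == zero_idx K.

(* [U (zero_idx K)] is unconstrained, and possibly not measurable, hence replaced by [0]. *)
Definition bounded_U : bounded_idx -> Om -> R := frozen U is_zero (fun=> 0) idx_of_bounded.

Lemma bounded_U_law : has_law P bounded_U (frozen_law P U is_zero (fun=> 0)).
Proof. by apply: has_law_frozen => // v v' _ _; exact: idx_of_bounded_inj. Qed.

Definition slice (i : idx K) (x : #|{: bounded_idx}|.-tuple R) : sub K -> R :=
  fun C => tnth x (enum_rank (bounded_of_idx (odot i C))).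

Lemma slice_joint (Z : Type) (X : bounded_idx -> Z -> R) i C z :
  slice i (joint X z) C = X (bounded_of_idx (odot i C)) z.
Proof. by rewrite /slice /joint tnth_mktuple enum_rankK. Qed.

Lemma bounded_U_odot i (C : sub K) w : admissible i -> C != finset.set0 ->
  bounded_U (bounded_of_idx (odot i C)) w = U (odot i C) w.
Proof.
move=> im C0; rewrite /bounded_U /frozen /is_zero bounded_of_idxK; last first.
  by move=> j; rewrite ffunE; case: (j \in C) => //; have /andP[] := im j.
by rewrite (negbTE (odot_neq0 _ C0))// => j; have /andP[] := im j.
Qed.

Definition mix (W : pred bounded_idx) (v : bounded_idx) (z : Om * Om) : R :=
  if W v then bounded_U v z.2 else bounded_U v z.1.

Lemma mix_law W : has_law (P \x P)%E (mix W) (frozen_law P U is_zero (fun=> 0)).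
Proof. apply: has_law_mixture; [exact: bounded_U_law|exact: bounded_U_law|exact: frozen_lawT]. Qed.

Lemma measurable_mix W w : measurable_fun setT (fun w' => joint (mix W) (w, w')).
Proof.
apply/measurable_fun_tnthP => j.
rewrite (_ : _ \o _ = fun w' => mix W (enum_val j) (w, w')); last first.
  by apply/funext => w' /=; rewrite tnth_mktuple.
rewrite /mix/=; case: (W _); first by case: bounded_U_law.
exact: measurable_cst.
Qed.

Lemma integral_mix W (phi : #|{: bounded_idx}|.-tuple R -> \bar R) :
  measurable_fun setT phi -> (forall x, (0 <= phi x)%E) ->
  (\int[P]_w \int[P]_w' phi (joint (mix W) (w, w')) = \int[P]_w phi (joint bounded_U w))%E.
Proof.
move=> mphi phi0; rewrite [RHS](has_law_integral bounded_U_law (mix_law W))//.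
rewrite [RHS]fubini_tonelli1//; apply: (measurableT_comp mphi).
by apply: measurable_joint; case: (mix_law W).
Qed.

Lemma measurable_slice i C : measurable_fun setT (slice i ^~ C).
Proof. exact: measurable_tnth. Qed.

Lemma measurable_Pe_slice (f : S -> R) (A : sub K) i : measurable_fun setT f ->
  measurable_fun setT (fun x => Pe P U tau f A (slice i x)).
Proof.
move=> mf.
have mS := measurable_Sfill iidU mtau (A := A) (fun C _ _ => measurable_slice i C).
have mfS : measurable_fun setT
    (fun z : (#|{: bounded_idx}|.-tuple R) * Om => (f (Sfill U tau A (slice i z.1) z.2))%:E).
  by apply/measurable_EFinP; exact: (measurableT_comp mf mS).
have mI : measurable_fun setT
    (fun x => \int[P]_w (f (Sfill U tau A (slice i x) w))%:E)%E.
  set h := (fun z : _ * Om => _) in mfS.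
  have -> : (fun x => \int[P]_w (f (Sfill U tau A (slice i x) w))%:E)%E =
     (fun x => \int[P]_w (h^\+ (x, w)) - \int[P]_w (h^\- (x, w)))%E.
    by apply/funext => x; rewrite integralE; congr (_ - _)%E;
      apply: eq_integral => w _; rewrite ?funeposE ?funenegE.
  apply: emeasurable_funB.
  - by apply: (measurable_fun_fubini_tonelli_F (m2 := P)) => //; exact: measurable_funepos.
  - by apply: (measurable_fun_fubini_tonelli_F (m2 := P)) => //; exact: measurable_funeneg.
exact: (measurableT_comp (fine_measurable measurableT) mI).
Qed.

Lemma Pe_slice_mix (f : S -> R) (A B : sub K) i W w w' : admissible i ->
  (forall C : sub K, C \subset A -> C != finset.set0 -> W (bounded_of_idx (odot i C)) = ~~ (C \subset B)) ->
  Pe P U tau f A (slice i (joint (mix W) (w, w'))) =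
  Pe P U tau f A (refill U B i (fun C => U (odot i C) w) w').
Proof.
move=> im hW; apply: Pe_ext => C CA C0.
rewrite slice_joint /mix hW// !bounded_U_odot// /refill; by case: (C \subset B).
Qed.

Section Contraction.
Variables (I : finType) (p : pred I) (idx_of : I -> idx K) (e : I -> R) (g : nat -> S -> R) (q : R).
Variables (A : sub K).
Hypothesis q1 : 1 <= q.
Hypothesis idx_of_admissible : forall t, p t -> admissible (idx_of t).
Hypothesis mg : forall n, measurable_fun setT (g n).

Definition Zsum n x : R := \sum_(t | p t) e t * Pe P U tau (g n) A (slice (idx_of t) x).
(** The supremum runs over a sequence of functions, which makes it measurable. *)
Definition Zsup x : \bar R := esups (fun n => (`|Zsum n x| `^ q)%:E) 0%N.

Lemma Zsup_ge n x : ((`|Zsum n x| `^ q)%:E <= Zsup x)%E.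
Proof. by apply: ereal_sup_ubound; exists n. Qed.

Lemma Zsup_ge0 x : (0 <= Zsup x)%E.
Proof. by apply: le_trans (Zsup_ge 0 x); rewrite lee_fin powR_ge0. Qed.

Lemma measurable_Zsum n : measurable_fun setT (Zsum n).
Proof.
rewrite (_ : Zsum n = fun x =>
    \sum_t (if p t then e t * Pe P U tau (g n) A (slice (idx_of t) x) else 0)); last first.
  by apply/funext => x; rewrite /Zsum big_mkcond.
apply: measurable_sum => t.
case: (p t); last exact: measurable_cst.
by apply: measurable_funM => //; exact: measurable_Pe_slice.
Qed.

Lemma measurable_Zsup : measurable_fun setT Zsup.
Proof.
apply: (measurable_fun_esups (f := fun n x => (`|Zsum n x| `^ q)%:E)) => n.
apply/measurable_EFinP; apply: (measurableT_comp (measurable_powR q)).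
by apply: measurableT_comp => //; exact: measurable_Zsum.
Qed.

(** By the tower property, integrating over the resampled entries turns each [P_A] into [P_(B t)],
    where [B t] may vary with [t]. The sum on the left is thus a mean of [Zsum n] over the second
    copy, and Jensen's inequality bounds it by the mean of the supremum. *)
Lemma cond_sum_le (W : pred bounded_idx) (B : I -> sub K) n w :
  (forall t, p t -> B t \subset A) ->
  (forall t (C : sub K), p t -> C \subset A -> C != finset.set0 ->
     W (bounded_of_idx (odot (idx_of t) C)) = ~~ (C \subset B t)) ->
  (forall t, p t -> P.-integrable setT
     (fun w' => (g n (Sfill U tau (B t) (fun C => U (odot (idx_of t) C) w) w'))%:E)) ->
  ((`|\sum_(t | p t) e t * Pe P U tau (g n) (B t) (fun C => U (odot (idx_of t) C) w)| `^ q)%:E <=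
   (2 `^ q)%:E * \int[P]_w' Zsup (joint (mix W) (w, w')))%E.
Proof.
move=> BA hW hint.
have ix0 t : p t -> forall j, (0 < idx_of t j)%N by move=> /idx_of_admissible im j; have /andP[] := im j.
have cond t : p t -> P.-integrable setT
      (fun w' => (Pe P U tau (g n) A (slice (idx_of t) (joint (mix W) (w, w'))))%:E) /\
    (\int[P]_w' (Pe P U tau (g n) A (slice (idx_of t) (joint (mix W) (w, w'))))%:E =
      (Pe P U tau (g n) (B t) (fun C => U (odot (idx_of t) C) w))%:E)%E.
  move=> pt; have := integral_refill_signed K_gt0 iidU mtau (ix0 _ pt) (BA _ pt) (mg n) (hint _ pt).
  have -> : (fun w' =>
      (Pe P U tau (g n) A (refill U (B t) (idx_of t) (fun C => U (odot (idx_of t) C) w) w'))%:E) =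
    (fun w' => (Pe P U tau (g n) A (slice (idx_of t) (joint (mix W) (w, w'))))%:E).
    by apply/funext => w'; rewrite (@Pe_slice_mix _ _ (B t))// => [|C]; [exact: idx_of_admissible|exact: hW].
  by [].
have intt t : P.-integrable setT (fun w' => if p t then
    (e t * Pe P U tau (g n) A (slice (idx_of t) (joint (mix W) (w, w'))))%:E else 0%E).
  case: (boolP (p t)) => pt; last exact: integrable0.
  under eq_fun do rewrite EFinM.
  by apply: integrableZl => //; have [] := cond t pt.
have ZE w' : (Zsum n (joint (mix W) (w, w')))%:E = (\sum_t if p t then
    (e t * Pe P U tau (g n) A (slice (idx_of t) (joint (mix W) (w, w'))))%:E else 0)%E.
  by rewrite /Zsum big_mkcond -sumEFin; apply: eq_bigr => t _; case: (p t).
have intZ : P.-integrable setT (EFin \o (fun w' => Zsum n (joint (mix W) (w, w')))).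
  rewrite (_ : _ \o _ = fun w' => \sum_t if p t then
    (e t * Pe P U tau (g n) A (slice (idx_of t) (joint (mix W) (w, w'))))%:E else 0)%E.
    exact: integrable_sum.
  by apply/funext => w'; rewrite /= ZE.
have := integral_powR_le q1 intZ.
have -> : (\int[P]_w' (Zsum n (joint (mix W) (w, w')))%:E)%E =
  (\sum_(t | p t) e t * Pe P U tau (g n) (B t) (fun C => U (odot (idx_of t) C) w))%:E.
  under eq_integral do rewrite ZE.
  rewrite integral_sum// [in RHS]big_mkcond -sumEFin; apply: eq_bigr => t _.
  case: (boolP (p t)) => pt; last by rewrite integral0.
  have [i1 i2] := cond t pt.
  by under eq_integral do rewrite EFinM; rewrite integralZl// i2.
move=> h; apply: (le_trans h); rewrite lee_pmul//.
- by apply: integral_ge0 => w' _; rewrite lee_fin powR_ge0.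
- apply: ge0_le_integral => //.
  + apply/measurable_EFinP; apply: (measurableT_comp (measurable_powR q)).
    apply: measurableT_comp => //.
    exact: (measurableT_comp (measurable_Zsum n) (measurable_mix W w)).
  + exact: (measurableT_comp measurable_Zsup (measurable_mix W w)).
  + by move=> w' _; exact: Zsup_ge.
Qed.

End Contraction.
End Array.

(** * Moebius inversion over subsets *)

Section Mobius.
Variables (R : realType) (J : finType).
Implicit Types (A B C : {set J}) (h : {set J} -> R).

(** For [B \subset A] this is [(-1) ^ #|A :\: B|], the Moebius function of the lattice of
    subsets. *)
Definition mob A B : R := \prod_(j in A) sgb R (j \in B).
Definition mobius_inv h A : R := \sum_(B : {set J} | B \subset A) mob A B * h B.

Lemma mobius_inv_setU1 h x A : x \notin A ->
  mobius_inv h (x |: A) = mobius_inv (fun B => h (x |: B)) A - mobius_inv h A.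
Proof.
move=> xA; rewrite /mobius_inv big_subsetU1// addrC -sumrN -!big_split/=.
have nA B : B \subset A -> x \notin B by move=> BA; apply: contra xA; apply/fintype.subsetP.
apply: eq_bigr => B BA; congr (_ + _).
  rewrite /mob big_setU1//= finset.setU11 /= mul1r; congr (_ * _).
  apply: eq_bigr => j jA; rewrite !inE; case: eqP => // jx.
  by rewrite jx (negbTE xA) in jA.
by rewrite /mob big_setU1//= (negbTE (nA _ BA)) mulN1r mulNr.
Qed.

(** For [x] outside [B], the inversions at [B] and at [x |: B] add up to the inversion at [B] of
    [fun C => h (x |: C)]; the sum thus reduces to one over subsets without [x]. *)
Lemma sum_mobius_inv h A : \sum_(B : {set J} | B \subset A) mobius_inv h B = h A.
Proof.
have [n] := ubnP #|A|; elim: n A h => // n IH A h leA.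
have [->|[x xA]] := finset.set_0Vmem A.
  have P0 : (fun S : {set J} => S \subset finset.set0) =1 pred1 finset.set0.
    by move=> B; rewrite finset.subset0.
  rewrite (big_pred1 _ P0) /mobius_inv (big_pred1 _ P0).
  by rewrite /mob big_set0 mul1r.
pose A' := A :\ x.
have xA' : x \notin A' by rewrite !inE eqxx.
have AE : A = x |: A' by rewrite finset.setD1K.
have leA' : (#|A'| < n)%N by move: leA; rewrite AE cardsU1 xA' add1n ltnS.
rewrite AE big_subsetU1// -[RHS](IH A' (fun B => h (x |: B)) leA') -big_split/=.
apply: eq_bigr => B BA; have xB : x \notin B.
  by apply: contra xA'; apply/fintype.subsetP.
by rewrite (mobius_inv_setU1 h xB) [LHS]addrC subrK.
Qed.

(** With [b] the signs met by a multi-index and [s] the resampled classes, these are the directions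
    in which it is left alone. *)
Definition toggle A (b : J -> bool) (s : {set J}) : {set J} := [set j in A | (j \in s) (+) b j].

Lemma toggle_sub A b s : toggle A b s \subset A.
Proof. by apply/fintype.subsetP => j; rewrite inE => /andP[]. Qed.

Lemma toggleK A b (s : {set J}) : s \subset A -> toggle A b (toggle A b s) = s.
Proof.
move=> /fintype.subsetP sA; apply/setP => j; rewrite !inE; case: (boolP (j \in A)) => jA /=.
  by rewrite addbK.
by apply/esym/negbTE; apply: contra jA; exact: sA.
Qed.

(** Toggling by [b] is an involution on the subsets of [A], and [- sgb s * sgb b] is [1] where [s]
    and [b] differ and [-1] where they agree, as the Moebius sign requires. The first product is
    free of [b], so it is common to all multi-indices. *)
Lemma mobius_inv_toggle h A (b : J -> bool) :
  mobius_inv h A = \sum_(s : {set J} | s \subset A)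
    (\prod_(j in A) - sgb R (j \in s)) * ((\prod_(j in A) sgb R (b j)) * h (toggle A b s)).
Proof.
rewrite /mobius_inv (reindex_onto (toggle A b) (toggle A b))/=; last first.
  by move=> s sA; rewrite toggleK.
apply: eq_big => [s|s sA].
  rewrite toggle_sub/=; apply/eqP/idP => [<-|]; [exact: toggle_sub|exact: toggleK].
rewrite mulrA; congr (_ * _); rewrite /mob -big_split/=; apply: eq_bigr => j jA.
rewrite inE jA/=; case: (j \in s); case: (b j); rewrite /sgb/=; ring.
Qed.

End Mobius.

(** * The recursive projections as Moebius inversions *)

Section HoeffdingProjection.
Context {R : realType} {K : nat} {d : measure_display} {S : measurableType d}
        {dO : measure_display} {Om : measurableType dO}.
Variables (P : probability Om R) (U : idx K -> Om -> R) (tau : famT R K -> S).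
Variables (f : S -> R) (u : sub K -> R).
Hypothesis Pe0 : Pe P U tau f finset.set0 u = 0.

(** The recursion subtracts the projections for the nonempty proper subsets; this is the inversion
    formula except for the empty set, whose term is zero by [Pe0]. Fuel [#|A|] suffices because the
    size drops at every call. *)
Lemma pi_rec_mobius m (A : sub K) : (#|A| <= m)%N ->
  pi_rec P U tau f m A u = mobius_inv (fun B => Pe P U tau f B u) A.
Proof.
set h := fun B => Pe P U tau f B u.
have h0 : mobius_inv h finset.set0 = 0.
  rewrite /mobius_inv big1// => B; rewrite finset.subset0 => /eqP ->.
  by rewrite /h Pe0 mulr0.
elim: m A => [|m IH] A Am.
  by move: Am; rewrite leqn0 cards_eq0 => /eqP ->; rewrite h0.
rewrite /= -/(h A) -(sum_mobius_inv h A) (bigD1 A)//= -addrA.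
rewrite [X in _ + X](_ : _ = 0) ?addr0//; apply/eqP; rewrite subr_eq0; apply/eqP.
rewrite (bigID (fun B : sub K => (0 < #|B|)%N))/= [X in _ + X]big1 ?addr0.
  apply: eq_big => [B|B /andP[BA _]]; first by rewrite finset.properEneq [(B != A) && _]andbC.
  apply/esym/IH; rewrite -ltnS; apply: leq_trans Am; apply: proper_card.
  by move: BA; rewrite finset.properEneq andbC.
by move=> B /andP[_]; rewrite -leqNgt leqn0 cards_eq0 => /eqP ->; rewrite h0.
Qed.

Lemma pie_mobius (A : sub K) : pie P U tau f A u = mobius_inv (fun B => Pe P U tau f B u) A.
Proof. exact: pi_rec_mobius. Qed.

End HoeffdingProjection.

(** * Chaining with respect to the empirical measure *)

Section EmpiricalEntropy.
Variables (R : realType) (J I : finType) (p : pred I) (Sx : I -> {set J}) (k : nat).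
Variables (D : Type) (u : I -> D) (T : set (D -> R)) (G : D -> R) (Jr : R).
Hypothesis Sx_inj : {in p &, injective Sx}.
Hypothesis Sx_card : forall t, p t -> #|Sx t| = k.
Hypothesis p_gt0 : (0 < #|p|)%N.
Hypothesis TG : forall f t, T f -> p t -> `|f (u t)| <= G (u t).

Let n : R := #|p|%:R.
Let n_gt0 : 0 < n. Proof. by rewrite ltr0n. Qed.

(** The discrete measure at which the uniform entropy is evaluated; coinciding sample points are
    listed repeatedly. *)
Definition empirical : seq (D * R) := [seq (u t, #|p|%:R^-1) | t <- index_enum I & p t].

Lemma empirical_sum (g : D -> R) :
  \sum_(x <- empirical) x.2 * g x.1 = n^-1 * \sum_(t | p t) g (u t).
Proof. by rewrite big_map big_filter/= mulr_sumr. Qed.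

Lemma empirical_prob : fin_discrete_prob empirical.
Proof.
split.
  move=> x; rewrite /empirical; elim: [seq t <- _ | p t] => //= t s IH [<-|/IH//].
  by rewrite /= invr_ge0.
transitivity (\sum_(x <- empirical) x.2 * (fun=> 1) x.1).
  by apply: eq_bigr => x _; rewrite mulr1.
by rewrite (empirical_sum (fun=> 1)) sumr_const -[1 *+ _]/n mulVf// gt_eqF.
Qed.

Lemma Qnorm2_empirical (g : D -> R) :
  Qnorm2 empirical g = Num.sqrt (n^-1 * sqsum p (fun t => g (u t))).
Proof. by rewrite /Qnorm2 (empirical_sum (fun x => g x ^+ 2)). Qed.

(** Under the root, 10 is the squared length of a link, [e ^ 2] the price of the union bound and
    [(2 m0) ^ k] Bonami's constant. The factor 2 comes from comparing the dyadic sum with the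
    integral, the summand 1 from the last link. *)
Definition chain_const (m0 : nat) : R := 2 * Num.sqrt (10 * expR 1 ^+ 2 * m0.*2%:R ^+ k) + 1.

(** The second alternative admits an infinite entropy: if the envelope vanishes on the sample, then
    so do all the chaoses. *)
Lemma empirical_chaining (m0 : nat) : (0 < m0)%N -> 1 <= Jr ->
  unif_entropy_integral k T G 1 = Jr%:E \/ sqsum p (fun t => G (u t)) = 0 ->
  exists M : {ffun J -> bool} -> R,
    (forall eps, 0 <= M eps) /\
    (forall f eps, T f -> `|chaos p Sx (fun t => f (u t)) eps| <= M eps) /\
    \sum_eps M eps ^+ m0.*2 <= #|{ffun J -> bool}|%:R *
      (Num.sqrt (sqsum p (fun t => G (u t))) * (chain_const m0 * Jr)) ^+ m0.*2.
Proof.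
move=> m00 J1 hJ; set v := sqsum _ _.
have v0 : 0 <= v by exact: sqsum_ge0.
have trivial : (forall f eps, T f -> chaos p Sx (fun t => f (u t)) eps = 0) ->
  exists M : {ffun J -> bool} -> R,
    (forall eps, 0 <= M eps) /\
    (forall f eps, T f -> `|chaos p Sx (fun t => f (u t)) eps| <= M eps) /\
    \sum_eps M eps ^+ m0.*2 <= #|{ffun J -> bool}|%:R *
      (Num.sqrt v * (chain_const m0 * Jr)) ^+ m0.*2.
  move=> z; exists (fun=> 0); split => //; split.
    by move=> f eps Tf; rewrite z// normr0.
  rewrite big1; last by move=> eps _; rewrite expr0n/= double_eq0 eqn0Ngt m00.
  by rewrite mulr_ge0// exprn_ge0// !mulr_ge0 ?sqrtr_ge0 ?addr_ge0 ?mulr_ge0 ?sqrtr_ge0//; lra.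
have [v00|vn0] := eqVneq v 0.
  apply: trivial => f eps Tf; rewrite /chaos big1// => t pt.
  suff -> : f (u t) = 0 by rewrite mul0r.
  apply/eqP; rewrite -normr_le0; apply: le_trans (TG Tf pt) _.
  have /psumr_eq0P : v = 0 by [].
  by move=> /(_ (fun t _ => sqr_ge0 _) t pt) /eqP; rewrite sqrf_eq0 => /eqP ->.
case: hJ => [JE|vz]; last by rewrite /v vz eqxx in vn0.
have [[f0 Tf0]|T0] := pselect (T !=set0); last first.
  by apply: trivial => f eps Tf; exfalso; apply: T0; exists f.
have vp : 0 < v by rewrite lt_def vn0.
have QT f : T f -> Qnorm2 empirical f <= Qnorm2 empirical G.
  move=> Tf; rewrite !Qnorm2_empirical ler_wsqrtr// ler_pM2l ?invr_gt0//.
  rewrite ler_sum// => t pt; rewrite -real_normK ?num_real// lerXn2r ?nnegrE//.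
    by apply: le_trans (TG Tf pt).
  exact: TG.
have [N [c [N0 c0 Nmono cov entL]]] :=
  entropy_levels empirical_prob (ex_intro _ f0 Tf0) JE QT.
pose TT : set (I -> R) := [set a | exists2 f, T f & a = fun t => f (u t)].
(* With this depth [#|p| / 2 ^ L] is at most 1, hence at most [Jr]. *)
pose L := #|p|.
have := @chaining R J I p Sx k Sx_inj Sx_card m0 TT v L N (fun l i t => c l i (u t)) m00 v0 N0.
case=> [|||M [M0 [hM momM]]].
- by rewrite c0.
- exact: Nmono.
- move=> l a lL [f Tf ->]; have [i iN hi] := cov l f Tf; exists i => //.
  move: hi; rewrite !Qnorm2_empirical -/v.
  set w := sqsum p _.
  have w0 : 0 <= w by exact: sqsum_ge0.
  have p2 : 0 < 2 ^+ l :> R by rewrite exprn_gt0.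
  have n'0 : 0 <= n^-1 by rewrite invr_ge0 ltW.
  rewrite -ler_sqr ?nnegrE ?sqrtr_ge0 ?divr_ge0 ?sqrtr_ge0 ?(ltW p2)//.
  rewrite expr_div_n !sqr_sqrtr ?mulr_ge0// -mulrA ler_pM2l ?invr_gt0//.
  by have -> : (4 : R) = 2 ^+ 2; [rewrite -natrX|rewrite -!exprM mulnC].
exists M; split => //; split.
  by move=> f eps Tf; apply: hM; exists f.
apply: le_trans momM _; rewrite ler_wpM2l// lerXn2r ?nnegrE//.
- rewrite mulr_ge0 ?sqrtr_ge0// addr_ge0 ?divr_ge0 ?exprn_ge0// mulr_ge0 ?sqrtr_ge0//.
  by rewrite sumr_ge0// => l _; rewrite divr_ge0 ?powR_ge0 ?exprn_ge0.
- by rewrite !mulr_ge0 ?sqrtr_ge0 ?addr_ge0 ?mulr_ge0 ?sqrtr_ge0//; lra.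
rewrite ler_wpM2l ?sqrtr_ge0// /chain_const [in leRHS]mulrDl mul1r lerD//.
  rewrite [2 * Num.sqrt _]mulrC -[leRHS]mulrA ler_wpM2l ?sqrtr_ge0//; exact: entL.
apply: le_trans J1; rewrite ler_pdivrMr ?exprn_gt0// mul1r -natrX ler_nat.
exact/ltnW/ltn_expl.
Qed.

(** The order is lowered from [2 m0] to [q] by the averaging inequality with exponent [2 m0 / q],
    whose loss is the factor 2. *)
Lemma empirical_moment (q : R) (m0 : nat) : (0 < m0)%N -> 1 <= Jr ->
  1 <= q -> q <= m0.*2%:R ->
  unif_entropy_integral k T G 1 = Jr%:E \/ sqsum p (fun t => G (u t)) = 0 ->
  exists M : {ffun J -> bool} -> R,
    (forall f eps, T f -> `|chaos p Sx (fun t => f (u t)) eps| `^ q <= M eps) /\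
    \sum_eps M eps <= #|{ffun J -> bool}|%:R *
      (2 * (Num.sqrt (sqsum p (fun t => G (u t))) * (chain_const m0 * Jr)) `^ q).
Proof.
move=> m00 J1 q1 qm hJ; have [M [M0 [hM momM]]] := empirical_chaining m00 J1 hJ.
set b := _ * (chain_const m0 * Jr) in momM *.
have b0 : 0 <= b.
  rewrite !mulr_ge0 ?sqrtr_ge0//; last lra.
  by rewrite addr_ge0// mulr_ge0// sqrtr_ge0.
have q0 : 0 < q by lra.
set c : R := #|{ffun J -> bool}|%:R in momM *.
have c0 : 0 < c by rewrite ltr0n; apply/card_gt0P; exists [ffun=> true].
exists (fun eps => M eps `^ q); split.
  by move=> f eps Tf; rewrite ge0_ler_powR ?nnegrE ?(ltW q0)// hM.
pose s := m0.*2%:R / q.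
have s1 : 1 <= s by rewrite ler_pdivlMr// mul1r.
have s0 : 0 < s by lra.
have := @average_powR_le R _ xpredT c s (fun eps => M eps `^ q) s1 c0 erefl (fun eps _ => powR_ge0 _ _).
set a := \sum_eps M eps `^ q.
have a0 : 0 <= a by rewrite sumr_ge0// => eps _; rewrite powR_ge0.
have -> : \sum_eps M eps `^ q `^ s = \sum_eps M eps ^+ m0.*2.
  apply: eq_bigr => eps _; rewrite -powRrM -powR_mulrn//; congr (_ `^ _).
  by rewrite /s mulrC divfK// gt_eqF.
move=> h.
have {}h : (c^-1 * a) `^ s <= (2 * b `^ q) `^ s.
  apply: (le_trans h); rewrite powRM ?powR_ge0// ler_wpM2l ?powR_ge0//.
  rewrite -powRrM (_ : q * s = m0.*2%:R) ?powR_mulrn//; last by rewrite /s mulrC divfK// gt_eqF.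
  by rewrite mulrC ler_pdivrMr// mulrC.
rewrite -ler_pdivrMl//.
have := @ge0_ler_powR R s^-1 _ ((c^-1 * a) `^ s) ((2 * b `^ q) `^ s).
rewrite -!powRrM divff ?gt_eqF// !powRr1 ?mulr_ge0 ?powR_ge0 ?invr_ge0 ?(ltW c0)//.
by apply; rewrite ?nnegrE ?powR_ge0 ?invr_ge0 ?(ltW s0).
Qed.

End EmpiricalEntropy.

(** * Almost everywhere bounds and roots of integrals *)

Section AlmostEverywhere.
Local Open Scope ereal_scope.
Context d (T : measurableType d) (R : realType) (mu : {measure set T -> \bar R}).

(** Adding [+oo] on the null set to [g] makes the bound hold everywhere and leaves the integral of
    [g] unchanged, so [f] can remain nonmeasurable. *)
Lemma ae_ge0_le_integral_nomeas (f g : T -> \bar R) :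
  (forall x, 0 <= f x) -> (forall x, 0 <= g x) -> measurable_fun setT g ->
  {ae mu, forall x, f x <= g x} -> \int[mu]_x f x <= \int[mu]_x g x.
Proof.
move=> f0 g0 mg [N [mN N0 subN]].
have mI : measurable_fun setT (fun x => (\1_N x)%:E : \bar R).
  by apply/measurable_EFinP; exact: measurable_indic.
pose z x : \bar R := +oo * (\1_N x)%:E.
have z0 x : 0 <= z x by rewrite mule_ge0// lee_fin.
have mz : measurable_fun setT z by exact: emeasurable_funM.
apply: (@le_trans _ _ (\int[mu]_x (g x + z x))).
  apply: ge0_le_integral_nomeas => // x _.
  have [xN|xN] := pselect (N x).
    by rewrite /z indicE mem_set// mule1 addey ?leey// gt_eqF// (lt_le_trans _ (g0 x)).
  rewrite /z indicE memNset// mule0 adde0.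
  by apply: contrapT => nle; apply: xN; exact: subN.
rewrite ge0_integralD// [X in _ + X](_ : _ = 0) ?adde0//.
by rewrite ge0_integralZl// integral_indic// setIT N0 mule0.
Qed.

End AlmostEverywhere.

Lemma integral_root_le (R : realType) d (T : measurableType d) (P : probability T R)
    (s B : R) (h : T -> R) :
  1 <= s -> 0 <= B -> measurable_fun setT h -> (forall x, 0 <= h x) ->
  (\int[P]_x (h x `^ s)%:E <= B%:E)%E -> (\int[P]_x (h x)%:E <= (2 * B `^ s^-1)%:E)%E.
Proof.
move=> s1 B0 mh h0 hB.
have s0 : 0 < s by lra.
have mhs : measurable_fun setT (fun x => (h x `^ s)%:E).
  by apply/measurable_EFinP; exact: (measurableT_comp (measurable_powR s) mh).
have mEh : measurable_fun setT (EFin \o h) by exact/measurable_EFinP.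
have ih : P.-integrable setT (EFin \o h).
  apply/integrableP; split => //.
  apply: (@le_lt_trans _ _ (\int[P]_x (cst 1 x + (h x `^ s)%:E))%E).
    apply: ge0_le_integral => //.
    - exact: measurableT_comp.
    - exact: emeasurable_funD.
    - move=> x _; rewrite /= ger0_norm// lee_fin.
      by have := le_add_powR s1 (h0 x) ltr01; rewrite powR1 mul1r.
  have c1 : (\int[P]_x (cst 1 x) = 1)%E.
    by rewrite integral_cst// mul1e; exact: probability_setT.
  rewrite ge0_integralD//; last by move=> x _; rewrite lee_fin powR_ge0.
  apply: (@le_lt_trans _ _ (1 + B%:E)%E); last by rewrite -EFinD ltry.
  by apply: leeD => //; rewrite -[leRHS]c1.
have := integral_powR_le s1 ih.
have -> : (\int[P]_w (`|h w| `^ s)%:E)%E = (\int[P]_w (h w `^ s)%:E)%E.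
  by apply: eq_integral => x _; rewrite ger0_norm.
have fi := integrable_fin_num measurableT ih.
have i0 : 0 <= fine (\int[P]_w (h w)%:E)%E.
  by rewrite fine_ge0// integral_ge0// => x _; rewrite lee_fin.
rewrite ger0_norm// => hh.
have {}hh : fine (\int[P]_w (h w)%:E)%E `^ s <= 2 `^ s * B.
  rewrite -lee_fin EFinM; apply: (le_trans hh); rewrite lee_pmul// ?lee_fin ?powR_ge0//.
  by apply: integral_ge0 => x _; rewrite lee_fin powR_ge0.
rewrite -(fineK fi) lee_fin.
have := @ge0_ler_powR R s^-1 _ (fine (\int[P]_w (h w)%:E)%E `^ s) (2 `^ s * B).
rewrite -powRrM divff ?gt_eqF// powRr1// powRM ?powR_ge0// -powRrM divff ?gt_eqF// powRr1//.
by apply; rewrite ?nnegrE ?mulr_ge0 ?powR_ge0 ?invr_ge0 ?(ltW s0).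
Qed.

(** * Sample indices, their signs and the resampled entries *)

Section Indices.
Variables (R : realType) (K : nat) (N : 'I_K -> nat) (A : sub K).
Hypothesis N_gt0 : forall j, (0 < N j)%N.

Definition multi_index : finType := {dffun forall j : 'I_K, 'I_(N j)}.
Definition in_slice (t : multi_index) := [forall j, (j \notin A) ==> (val (t j) == 0%N)].
Definition idx_of (t : multi_index) : idx K := [ffun j => (val (t j)).+1].
Definition Nsum := (\sum_j N j)%N.

Lemma idx_of_admissible t : admissible Nsum (idx_of t).
Proof.
move=> j; rewrite ffunE /=; apply: leq_trans (ltn_ord (t j)) _.
by rewrite /Nsum (bigD1 j)//= leq_addr.
Qed.

Lemma idx_of_gt0 t j : (0 < idx_of t j)%N. Proof. by rewrite ffunE. Qed.

Lemma card_in_slice : #|in_slice| = cardI N A.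
Proof.
pose F (j : 'I_K) : pred 'I_(N j) := fun y => (j \notin A) ==> (val y == 0%N).
have -> : #|in_slice| = #|(family F : simpl_pred {dffun forall j : 'I_K, 'I_(N j)})|.
  by apply: eq_card => t; apply/forallP/familyP => h j; have := h j.
rewrite card_family /cardI [RHS]big_mkcond/=.
have foldrE (s : seq nat) : foldr muln 1%N s = (\prod_(a <- s) a)%N.
  by elim: s => [|a s IH]; rewrite ?big_nil// big_cons /= IH.
rewrite foldrE big_map big_enum/=.
apply: eq_bigr => j _; case: ifPn => jA.
  rewrite -[RHS]card_ord; apply: eq_card => y; rewrite !inE /F.
  by rewrite unfold_in jA.
rewrite (fintype.eq_card1 (x := Ordinal (N_gt0 j)))// => y.
rewrite unfold_in /F jA /= inE; by apply/eqP/eqP => [h|->//]; apply/val_inj.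
Qed.

Lemma card_in_slice_gt0 : (0 < #|in_slice|)%N.
Proof. by rewrite card_in_slice prodn_gt0. Qed.

Let bix (t : multi_index) : @bounded_idx K Nsum := bounded_of_idx Nsum (idx_of t).

Lemma bixE t j : (bix t j : nat) = (val (t j)).+1.
Proof.
rewrite !ffunE inordK//.
by have /andP[_] := idx_of_admissible t j; rewrite ffunE ltnS.
Qed.

(** There is one sign for each pair of a direction and an index value; the Walsh function of this
    set is the product [eps_i]. *)
Definition signset (t : multi_index) : {set 'I_K * 'I_Nsum.+1} :=
  [set (j, bounded_of_idx Nsum (idx_of t) j) | j in A].

Lemma signset_inj : {in in_slice &, injective signset}.
Proof.
move=> t t' /forallP pt /forallP pt' E; apply/ffunP => j; apply/val_inj.
case: (boolP (j \in A)) => jA; last first.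
  by have := pt j; have := pt' j; rewrite jA /= => /eqP -> /eqP ->.
have : (j, bix t j) \in signset t' by rewrite -E; apply/imsetP; exists j.
case/imsetP => j' _ [<- E'].
by have := congr1 val E'; rewrite /= !bixE => -[].
Qed.

Lemma card_signset t : #|signset t| = #|A|.
Proof. by rewrite card_imset// => j j' []. Qed.

Lemma walsh_signset t eps :
  walsh R (signset t) eps = \prod_(j in A) sgb R (eps (j, bounded_of_idx Nsum (idx_of t) j)).
Proof. by rewrite /walsh /signset big_imset//= => j j' _ _ []. Qed.

(* In each direction [j] of [A], [s] selects one of the two classes into which the signs [eps]
   split the values of the index; the entries with an index in a selected class are resampled. *)
Definition resampled (eps : {ffun 'I_K * 'I_Nsum.+1 -> bool}) (s : sub K) (v : @bounded_idx K Nsum) :=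
  [exists j in A, (v j != 0%N :> nat) && (eps (j, v j) == (j \in s))].

Definition kept (eps : {ffun 'I_K * 'I_Nsum.+1 -> bool}) (s : sub K) (t : multi_index) : sub K :=
  toggle A (fun j => eps (j, bounded_of_idx Nsum (idx_of t) j)) s.

(** An entry survives exactly when every direction on which it depends is kept. The test on the
    value 0 in [resampled] discards the directions outside [C], where [odot] writes 0. *)
Lemma resampledE eps s t (C : sub K) : C \subset A ->
  resampled eps s (bounded_of_idx Nsum (odot (idx_of t) C)) = ~~ (C \subset kept eps s t).
Proof.
move=> /fintype.subsetP CA.
have vE j : bounded_of_idx Nsum (odot (idx_of t) C) j = if j \in C then bix t j else ord0.
  apply/val_inj; rewrite /bix !ffunE; by case: ifP => _ //; exact: inordK.
apply/existsP/fintype.subsetPn => [[j /andP[jA /andP[v0 /eqP ej]]]|[j jC jT]].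
  move: v0 ej; rewrite vE; case: ifP => // jC _ ej; exists j => //.
  by rewrite /kept /toggle inE jA /= -ej addbb.
exists j; rewrite CA//= vE jC bixE/=; move: jT; rewrite /kept /toggle inE CA//=.
by rewrite -/(bix t); case: (eps _); case: (j \in s).
Qed.

End Indices.

Lemma cvg_sum_seq (R : realType) (I : Type) (s : seq I) (p : pred I) (F : I -> nat -> R) (L : I -> R) :
  (forall i, p i -> F i n @[n --> \oo] --> L i) ->
  (\sum_(i <- s | p i) F i n) @[n --> \oo] --> \sum_(i <- s | p i) L i.
Proof.
move=> FL; elim: s => [|i s IH].
  by rewrite big_nil; under eq_fun do rewrite big_nil; exact: cvg_cst.
rewrite big_cons; under eq_fun do rewrite big_cons.
by case: ifPn => // pi; apply: cvgD => //; exact: FL.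
Qed.

Lemma sume_cst (R : realType) (I : finType) (x : \bar R) :
  (\sum_(i : I) x = #|{: I}|%:R%:E * x)%E.
Proof.
transitivity (\sum_(i : I) 1 * x)%E; first by apply: eq_bigr => i _; rewrite mul1e.
rewrite -ge0_sume_distrl; last by move=> _ _; exact: lee01.
by rewrite sumEFin sumr_const.
Qed.

(** * The moment bound for the supremum over the class *)

Section MaximalInequality.
Context {R : realType} {K : nat} {d : measure_display} {S : measurableType d}
        {dO : measure_display} {Om : measurableType dO}.
Variables (P : probability Om R) (U : idx K -> Om -> R) (tau : famT R K -> S).
Variables (Fcl : set (S -> R)) (Fenv : S -> R) (g : nat -> S -> R).
Variables (N : 'I_K -> nat) (A : sub K) (q : R) (V : R).
Hypothesis K_gt0 : (0 < K)%N.
Hypothesis iidU : iid P [set v : idx K | v != zero_idx K] U.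
Hypothesis mtau : measurable_fun setT tau.
Hypothesis Fmeas : forall f, Fcl f -> measurable_fun setT f.
Hypothesis Fenvelope : envelope Fcl Fenv.
Hypothesis mFenv : measurable_fun setT Fenv.
Hypothesis Fcent : forall f, Fcl f ->
  (\int[P]_w (f (Xarr U tau (one_idx K) w))%:E = 0)%E.
Hypothesis gF : forall n, Fcl (g n).
Hypothesis Fg : forall f, Fcl f -> exists h : nat -> nat, forall x, g (h n) x @[n --> \oo] --> f x.
Hypothesis N_gt0 : forall j, (0 < N j)%N.
Hypothesis q1 : 1 <= q.

Local Notation r := (Num.max q 2).
Hypothesis VE : (\int[P]_w ((Fenv (Xarr U tau (one_idx K) w)) `^ r)%:E = V%:E)%E.

Local Notation m := (Nsum N).
Local Notation p := (in_slice (N := N) A).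

Definition Uarr (t : multi_index N) (w : Om) : sub K -> R := fun C => U (odot (idx_of t) C) w.

(** At such points [Pe] of every member of the class is the true integral, is dominated by [Pe] of
    the envelope, and passes to dominated limits. *)
Definition good (w : Om) := forall (t : multi_index N) (B : sub K),
  P.-integrable setT (fun w' => (Fenv (Sfill U tau B (Uarr t w) w'))%:E).

Lemma Fenv_ge0 x : 0 <= Fenv x. Proof. by case: (Fenvelope x). Qed.

Lemma r_ge1 : 1 <= r. Proof. by rewrite le_max q1. Qed.

Lemma V_ge0 : 0 <= V.
Proof. by rewrite -lee_fin -VE integral_ge0// => w _; rewrite lee_fin powR_ge0. Qed.

Lemma Sfill_set0 (u : sub K -> R) w : Sfill U tau finset.set0 u w = Xarr U tau (one_idx K) w.
Proof.
congr tau; apply: tau_in_ext => C C0; rewrite finset.subset0; by rewrite (negbTE C0).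
Qed.

(** The tower property with nothing frozen. *)
Lemma integral_Sfill (phi : S -> \bar R) t B : measurable_fun setT phi -> (forall x, (0 <= phi x)%E) ->
  (\int[P]_w \int[P]_w' phi (Sfill U tau B (Uarr t w) w') =
   \int[P]_w phi (Xarr U tau (one_idx K) w))%E.
Proof.
move=> mphi phi0.
have := integral_refill K_gt0 iidU mtau (fun=> 0) (idx_of_gt0 t) (finset.sub0set B) mphi phi0.
under [in RHS]eq_integral do rewrite Sfill_set0.
move=> <-; apply: eq_integral => w _; apply: eq_integral => w' _.
congr phi; apply: Sfill_ext => C CB C0.
by rewrite /refill finset.subset0 (negbTE C0).
Qed.

Lemma measurable_Uarr t (C : sub K) : C != finset.set0 -> measurable_fun setT ((Uarr t)^~ C).
Proof. by move=> C0; apply: measurable_U iidU _ _; apply: odot_neq0 => // j; exact: idx_of_gt0. Qed.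

Lemma measurable_Sfill_Uarr t B :
  measurable_fun setT (fun z : Om * Om => Sfill U tau B (Uarr t z.1) z.2).
Proof. by apply: (measurable_Sfill iidU mtau) => C _ C0; exact: measurable_Uarr. Qed.

Lemma ae_good : {ae P, forall w, good w}.
Proof.
apply: filter_forall => t; apply: filter_forall => B.
pose h (z : Om * Om) : \bar R := (Fenv (Sfill U tau B (Uarr t z.1) z.2))%:E.
have mE : measurable_fun setT (EFin \o Fenv) by exact/measurable_EFinP.
have mh : measurable_fun setT h by exact: (measurableT_comp mE (measurable_Sfill_Uarr t B)).
have F0 x : (0 <= (EFin \o Fenv) x)%E by rewrite lee_fin Fenv_ge0.
have ih : (P \x P)%E.-integrable setT h.
  apply/integrable12ltyP => //.
  have -> : (\int[P]_x \int[P]_y `|h (x, y)| =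
      \int[P]_w (EFin \o Fenv) (Xarr U tau (one_idx K) w))%E.
    rewrite -(integral_Sfill t B mE F0); apply: eq_integral => w _; apply: eq_integral => w' _.
    by rewrite gee0_abs// lee_fin Fenv_ge0.
  have mX : measurable_fun setT (fun w => Fenv (Xarr U tau (one_idx K) w)).
    apply: (measurableT_comp mFenv); apply: (measurable_tau mtau) => C C0.
    by apply: measurable_U iidU _ _; apply: odot_neq0 => // j; rewrite ffunE.
  have := @integral_root_le R _ _ P r V _ r_ge1 V_ge0 mX (fun w => Fenv_ge0 _).
  by rewrite VE => /(_ (lexx _)) h1; apply: le_lt_trans h1 (ltry _).
by have := ae_integrable1 ih; apply: filterS.
Qed.

Lemma good_integrable f w t B : good w -> Fcl f ->
  P.-integrable setT (fun w' => (f (Sfill U tau B (Uarr t w) w'))%:E).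
Proof.
move=> gw Ff; apply: le_integrable (gw t B) => //.
  apply/measurable_EFinP; apply: (measurableT_comp (Fmeas Ff)).
  exact: (measurable_Sfill_fixed iidU mtau).
move=> w' _; rewrite /= lee_fin [leRHS]ger0_norm ?Fenv_ge0//.
by have [_] := Fenvelope (Sfill U tau B (Uarr t w) w'); apply.
Qed.

Lemma Pe_le f w t B : good w -> Fcl f ->
  `|Pe P U tau f B (Uarr t w)| <= Pe P U tau Fenv B (Uarr t w).
Proof.
move=> gw Ff; rewrite !PeE.
have i1 := good_integrable t B gw Ff; have i2 := gw t B.
have f1 := integrable_fin_num measurableT i1; have f2 := integrable_fin_num measurableT i2.
rewrite -lee_fin -abse_EFin !fineK//.
apply: le_trans (le_abse_integral _ measurableT (measurable_int _ i1)) _.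
apply: ge0_le_integral => //.
- by apply: measurableT_comp => //; exact: measurable_int i1.
- exact: measurable_int i2.
- by move=> w' _; rewrite /= lee_fin; have [_] := Fenvelope (Sfill U tau B (Uarr t w) w'); apply.
Qed.

Lemma Pe_set0 f u : Fcl f -> Pe P U tau f finset.set0 u = 0.
Proof.
move=> Ff; rewrite PeE.
by under eq_integral do rewrite Sfill_set0; rewrite Fcent.
Qed.

Lemma Pe_cvg f (h : nat -> nat) w t B : good w -> Fcl f ->
  (forall x, g (h n) x @[n --> \oo] --> f x) ->
  Pe P U tau (g (h n)) B (Uarr t w) @[n --> \oo] --> Pe P U tau f B (Uarr t w).
Proof.
move=> gw Ff hf.
have mE f' : Fcl f' -> measurable_fun setT (fun w' => (f' (Sfill U tau B (Uarr t w) w'))%:E).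
  by move=> Ff'; exact: measurable_int (good_integrable t B gw Ff').
have [] := @dominated_convergence _ _ _ P setT measurableT
  (fun n w' => (g (h n) (Sfill U tau B (Uarr t w) w'))%:E)
  (fun w' => (f (Sfill U tau B (Uarr t w) w'))%:E)
  (fun w' => (Fenv (Sfill U tau B (Uarr t w) w'))%:E).
- by move=> n; exact: mE (gF (h n)).
- exact: mE Ff.
- apply: aeW => w' _; apply: cvg_EFin; first exact: nearW.
  exact: hf.
- exact: gw t B.
- apply: aeW => w' n _; rewrite lee_fin.
  by have [_ /(_ _ (gF (h n)))] := Fenvelope (Sfill U tau B (Uarr t w) w').
move=> _ _ cv; rewrite !PeE.
apply: fine_cvg; rewrite fineK//; exact: integrable_fin_num (good_integrable t B gw Ff).
Qed.

Definition Ssum f w : R := \sum_(t | p t) pie P U tau f A (Uarr t w).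

(** The Moebius sum of each multi-index is toggled by its own signs. The coefficients in [s] are
    then the same for all of them, which permits the exchange of sums. *)
Lemma Ssum_signed f w (eps : {ffun 'I_K * 'I_m.+1 -> bool}) : Fcl f ->
  Ssum f w = \sum_(s : sub K | s \subset A) (\prod_(j in A) - sgb R (j \in s)) *
    \sum_(t | p t) walsh R (signset A t) eps * Pe P U tau f (kept A eps s t) (Uarr t w).
Proof.
move=> Ff; rewrite /Ssum.
under eq_bigr => t pt.
  rewrite pie_mobius ?Pe_set0//.
  rewrite (mobius_inv_toggle _ _ (fun j => eps (j, bounded_of_idx m (idx_of t) j))).
  rewrite -walsh_signset.
  over.
rewrite exchange_big/=; apply: eq_bigr => s sA.
by rewrite mulr_sumr.
Qed.

Definition sym_sup (eps : {ffun 'I_K * 'I_m.+1 -> bool}) : #|{: @bounded_idx K m}|.-tuple R -> \bar R :=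
  Zsup P U tau p (@idx_of K N) (fun t => walsh R (signset A t) eps) g q A.

Definition sub_card : R := #|{: sub K}|%:R.

(** [sub_card] bounds the number of choices [s]; the 4 is a factor 2 from averaging over these
    choices times a factor 2 from the conditional mean in [cond_sum_le]. *)
Lemma Ssum_le_g w eps n : good w ->
  ((`|Ssum (g n) w| `^ q)%:E <= ((sub_card * 4) `^ q)%:E *
    \sum_(s : sub K | s \subset A) \int[P]_w' sym_sup eps (joint (mix U (resampled A eps s)) (w, w')))%E.
Proof.
move=> gw; rewrite (Ssum_signed _ eps (gF n)).
set y := fun s : sub K => `|\sum_(t | p t) walsh R (signset A t) eps *
  Pe P U tau (g n) (kept A eps s t) (Uarr t w)|.
have y_le (s : sub K) : s \subset A -> ((y s `^ q)%:E <= (2 `^ q)%:E *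
    \int[P]_w' sym_sup eps (joint (mix U (resampled A eps s)) (w, w')))%E.
  move=> sA; apply: (cond_sum_le K_gt0 iidU mtau) => //.
  - by move=> t _; exact: idx_of_admissible.
  - by move=> l; exact: Fmeas.
  - by move=> t _; exact: toggle_sub.
  - by move=> t C _ CA _; exact: resampledE.
  - by move=> t _; exact: good_integrable.
have q0 : 0 < q by exact: lt_le_trans ltr01 q1.
pose pA := [pred s : sub K | s \subset A].
pose nA : R := #|pA|%:R.
have nA1 : 1 <= nA by rewrite ler1n; apply/card_gt0P; exists A; rewrite inE.
have nAle : nA <= sub_card by rewrite ler_nat max_card.
have nA0 : 0 < nA by exact: lt_le_trans ltr01 nA1.
have sc0 : 0 < sub_card by exact: lt_le_trans nA0 nAle.
have y0 s : 0 <= y s by exact: normr_ge0.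
apply: (@le_trans _ _ ((\sum_(s : sub K | s \subset A) y s) `^ q)%:E).
  rewrite lee_fin ge0_ler_powR ?nnegrE ?(ltW q0) ?sumr_ge0//.
  apply: le_trans (ler_norm_sum _ _ _) _; apply: ler_sum => s sA.
  rewrite normrM normr_prod big1 ?mul1r// => j _.
  by rewrite normrN /sgb; case: (j \in s); rewrite ?normrN normr1.
have := @average_powR_le R _ pA nA q y q1 nA0 erefl (fun s _ => y0 s).
have -> : \sum_(s | pA s) y s = \sum_(s : sub K | s \subset A) y s by apply: eq_bigl => s; rewrite inE.
have -> : \sum_(s | pA s) y s `^ q = \sum_(s : sub K | s \subset A) y s `^ q.
  by apply: eq_bigl => s; rewrite inE.
set a := \sum_(s : sub K | _) y s; set b := \sum_(s : sub K | _) _.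
have a0 : 0 <= a by rewrite sumr_ge0.
have b0 : 0 <= b by rewrite sumr_ge0// => s _; rewrite powR_ge0.
move=> ab.
have {}ab : a `^ q <= (sub_card * 2) `^ q * b.
  have -> : a = nA * (nA^-1 * a) by rewrite mulrA divff ?mul1r ?gt_eqF.
  rewrite powRM ?mulr_ge0 ?invr_ge0 ?(ltW nA0)// powRM ?(ltW sc0)// -mulrA ler_pM ?powR_ge0//.
    by rewrite ge0_ler_powR ?nnegrE ?(ltW q0) ?(ltW nA0) ?(ltW sc0).
  apply: (le_trans ab); rewrite ler_wpM2l ?powR_ge0//.
  by rewrite ler_piMl// invf_le1.
apply: (@le_trans _ _ ((sub_card * 2) `^ q * b)%:E); first by rewrite lee_fin.
have -> : sub_card * 4 = sub_card * 2 * 2 by rewrite -mulrA; congr (_ * _); rewrite -natrM.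
rewrite [in leRHS]powRM ?mulr_ge0 ?(ltW sc0)// !EFinM -muleA.
apply: lee_pmul => //; rewrite ?lee_fin ?powR_ge0//.
rewrite -sumEFin ge0_sume_distrr; last first.
  by move=> s _; apply: integral_ge0 => w' _; exact: Zsup_ge0.
exact: lee_sum.
Qed.

(** At a good point dominated convergence carries the estimate from the sequence to every member of
    the class, since the bound is the same for all [n]. The limit is taken after extracting the
    root, in [Ssum] itself. *)
Lemma Ssum_le f w eps : good w -> Fcl f ->
  ((`|Ssum f w| `^ q)%:E <= ((sub_card * 4) `^ q)%:E *
    \sum_(s : sub K | s \subset A) \int[P]_w' sym_sup eps (joint (mix U (resampled A eps s)) (w, w')))%E.
Proof.
move=> gw Ff; have [h hf] := Fg Ff.
have q0 : 0 < q by exact: lt_le_trans ltr01 q1.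
have cvS : Ssum (g (h n)) w @[n --> \oo] --> Ssum f w.
  have -> : (fun n => Ssum (g (h n)) w) = (fun n => \sum_(t | p t)
     mobius_inv (fun B => Pe P U tau (g (h n)) B (Uarr t w)) A).
    apply/funext => n; apply: eq_bigr => t _; rewrite pie_mobius// Pe_set0//; exact: gF.
  have -> : Ssum f w = \sum_(t | p t) mobius_inv (fun B => Pe P U tau f B (Uarr t w)) A.
    by apply: eq_bigr => t _; rewrite pie_mobius// Pe_set0.
  apply: cvg_sum_seq => t _; apply: cvg_sum_seq => B _; apply: cvgMl_tmp; exact: Pe_cvg.
set X := (_ * _)%E.
have Xge n : ((`|Ssum (g (h n)) w| `^ q)%:E <= X)%E by exact: Ssum_le_g.
have X0 : (0 <= X)%E by apply: le_trans (Xge 0%N); rewrite lee_fin powR_ge0.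
case: X Xge X0 => [x| |//] Xge X0; last by rewrite leey.
rewrite lee_fin in X0.
have root y : 0 <= y -> y `^ q <= x -> y <= x `^ q^-1.
  move=> y0 yx; have := @ge0_ler_powR R q^-1 _ (y `^ q) x.
  rewrite -powRrM divff ?gt_eqF// powRr1//.
  by apply; rewrite ?nnegrE ?powR_ge0 ?invr_ge0 ?(ltW q0).
rewrite lee_fin.
have le : `|Ssum f w| <= x `^ q^-1.
  have cvN : `|Ssum (g (h n)) w| @[n --> \oo] --> `|Ssum f w| by exact: cvg_norm.
  rewrite -(cvg_lim _ cvN)//; apply: limr_le.
    by apply/cvg_ex; exists `|Ssum f w|.
  by near=> n; apply: root => //; rewrite -lee_fin; exact: Xge.
apply: (@le_trans _ _ (x `^ q^-1 `^ q)).
  by rewrite ge0_ler_powR ?nnegrE ?powR_ge0 ?(ltW q0).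
by rewrite -powRrM mulVf ?gt_eqF// powRr1.
Unshelve. all: by end_near. Qed.


Definition Hsup (w : Om) : \bar R :=
  ereal_sup [set (`|Hen P U tau N f A w| `^ q)%:E | f in Fcl].

Let nn : R := (cardI N A)%:R.

Let nn_gt0 : 0 < nn. Proof. by rewrite ltr0n prodn_gt0. Qed.

Lemma HenE f w : Hen P U tau N f A w = nn^-1 * Ssum f w.
Proof. by []. Qed.

Lemma Hsup_ge0 w : (0 <= Hsup w)%E.
Proof.
apply: le_trans (ereal_sup_ubound (_ : _ (`|Hen P U tau N (g 0%N) A w| `^ q)%:E)).
  by rewrite lee_fin powR_ge0.
by exists (g 0%N).
Qed.

Lemma sym_sup_ge0 eps x : (0 <= sym_sup eps x)%E. Proof. exact: Zsup_ge0. Qed.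

Lemma measurable_sym_sup eps : measurable_fun setT (sym_sup eps).
Proof. by apply: measurable_Zsup => // n; exact: Fmeas. Qed.

(** The last factor bounds the number of terms of the sum over [s], all of which have the same
    integral. *)
Definition symm_const : R := (sub_card * 4) `^ q * sub_card.

Lemma sub_card_gt0 : 0 < sub_card.
Proof. by rewrite ltr0n; apply/card_gt0P; exists finset.set0. Qed.

(** The majorant of [Ssum_le] is measurable in [w], though [Hsup] may not be; integrating it
    restores the law of the original array for each choice [s]. *)
Lemma integral_Hsup_le eps :
  (\int[P]_w Hsup w <= (nn^-1 `^ q * symm_const)%:E *
    \int[P]_w sym_sup eps (joint (bounded_U U (m := m)) w))%E.
Proof.
set Iz := (\int[P]_w sym_sup eps _)%E.
have Iz0 : (0 <= Iz)%E by apply: integral_ge0 => w _; exact: sym_sup_ge0.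
pose h s w := (\int[P]_w' sym_sup eps (joint (mix U (resampled A eps s)) (w, w')))%E.
have h0 s w : (0 <= h s w)%E by apply: integral_ge0 => w' _; exact: sym_sup_ge0.
have mh s : measurable_fun setT (h s).
  apply: (measurable_fun_fubini_tonelli_F (m2 := P)
    (fun z => sym_sup eps (joint (mix U (resampled A eps s)) z))).
    apply: (measurableT_comp (measurable_sym_sup eps)); apply: measurable_joint.
    by have [] := mix_law K_gt0 iidU (resampled A eps s).
  by move=> z; exact: sym_sup_ge0.
have ih s : (\int[P]_w h s w = Iz)%E.
  by rewrite /h (integral_mix K_gt0 iidU _ (measurable_sym_sup eps) (sym_sup_ge0 eps)).
pose H w := (\sum_(s : sub K | s \subset A) h s w)%E.
have sum_hE w : H w = (\sum_(s : sub K) (if s \subset A then h s w else 0))%E by rewrite /H big_mkcond.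
have H0 w : (0 <= H w)%E by apply: sume_ge0 => s _; exact: h0.
have mH : measurable_fun setT H.
  rewrite (_ : H = fun w => (\sum_(s : sub K) (if s \subset A then h s w else 0))%E); last exact/funext.
  by apply: emeasurable_sum => s; case: (s \subset A) => //; exact: measurable_cst.
pose c : R := nn^-1 `^ q * (sub_card * 4) `^ q.
have c0 : 0 <= c by rewrite mulr_ge0 ?powR_ge0.
apply: (@le_trans _ _ (\int[P]_w (c%:E * H w))%E).
  apply: ae_ge0_le_integral_nomeas.
  - exact: Hsup_ge0.
  - by move=> w; apply: mule_ge0; [exact: c0|exact: H0].
  - by apply: emeasurable_funM => //; exact: mH.
  - apply: filterS ae_good => w gw; apply: ge_ereal_sup => _ [f Ff <-].
    rewrite HenE normrM gtr0_norm ?invr_gt0// powRM ?invr_ge0 ?(ltW nn_gt0)//.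
    rewrite EFinM /c EFinM -muleA; apply: lee_pmul => //; rewrite ?lee_fin ?powR_ge0//.
    exact: Ssum_le.
rewrite ge0_integralZl_EFin//.
rewrite (_ : nn^-1 `^ q * symm_const = c * sub_card); last by rewrite /symm_const mulrA.
rewrite (EFinM c) -[leRHS]muleA; apply: lee_pmul => //.
  by apply: integral_ge0 => w _; exact: H0.
rewrite (eq_integral (fun w => \sum_(s : sub K) (if s \subset A then h s w else 0))%E); last first.
  by move=> w _; rewrite sum_hE.
rewrite ge0_integral_sum//; last 2 first.
- by move=> s; case: (s \subset A) => //; exact: measurable_cst.
- by move=> s w _; case: (s \subset A); [exact: h0|exact: lexx].
apply: (@le_trans _ _ (\sum_(s : sub K) Iz)%E).
  apply: lee_sum => s _; case: (s \subset A); first by rewrite ih.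
  by rewrite integral0.
rewrite sume_cst /sub_card; exact: lexx.
Qed.

Definition vsum (w : Om) : R := sqsum p (fun t => Pe P U tau Fenv A (Uarr t w)).

Variables (m0 : nat) (Jr : R).
Hypothesis m0_gt0 : (0 < m0)%N.
Hypothesis q_le : q <= m0.*2%:R.
Hypothesis Jr_ge1 : 1 <= Jr.

Let D : R := chain_const R #|A| m0.

(** Here the array is fixed and only the signs vary, so chaining applies with the values of [Uarr]
    as sample points. *)
Lemma sum_sym_sup_le w : good w ->
  unif_entropy_integral #|A| [set Pe P U tau f A | f in Fcl] (Pe P U tau Fenv A) 1 = Jr%:E
    \/ vsum w = 0 ->
  (\sum_(eps : {ffun 'I_K * 'I_m.+1 -> bool}) sym_sup eps (joint (bounded_U U (m := m)) w) <=
   (#|{ffun 'I_K * 'I_m.+1 -> bool}|%:R * (2 * (Num.sqrt (vsum w) * (D * Jr)) `^ q))%:E)%E.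
Proof.
move=> gw hJ.
have TG f t : [set Pe P U tau f A | f in Fcl] f -> p t -> `|f (Uarr t w)| <= Pe P U tau Fenv A (Uarr t w).
  by move=> [f' Ff' <-] _; exact: Pe_le.
have [M [hM sumM]] := empirical_moment (signset_inj (A := A)) (fun t _ => card_signset A t)
  (card_in_slice_gt0 A N_gt0) TG m0_gt0 Jr_ge1 q1 q_le hJ.
apply: le_trans (_ : (\sum_eps (M eps)%:E <= _)%E); last by rewrite sumEFin lee_fin.
apply: lee_sum => eps _; apply: ge_ereal_sup => _ [n _ <-]; rewrite lee_fin.
have := hM (Pe P U tau (g n) A) eps (ex_intro2 _ _ _ (gF n) erefl).
suff -> : Zsum P U tau p (@idx_of K N) (fun t => walsh R (signset A t) eps) g A n
    (joint (bounded_U U (m := m)) w) = chaos p (signset A) (fun t => Pe P U tau (g n) A (Uarr t w)) eps by [].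
rewrite /Zsum /chaos; apply: eq_bigr => t _; rewrite mulrC; congr (_ * _).
apply: Pe_ext => C CA C0; rewrite slice_joint bounded_U_odot//; exact: idx_of_admissible.
Qed.

Lemma measurable_PeFenv t : measurable_fun setT (fun w => Pe P U tau Fenv A (Uarr t w)).
Proof.
have mE : measurable_fun setT (EFin \o Fenv) by exact/measurable_EFinP.
apply: (measurableT_comp (fine_measurable measurableT)).
apply: (measurable_fun_fubini_tonelli_F (m2 := P)
  (fun z => (Fenv (Sfill U tau A (Uarr t z.1) z.2))%:E)).
  exact: (measurableT_comp mE (measurable_Sfill_Uarr t A)).
by move=> z; rewrite lee_fin Fenv_ge0.
Qed.

Lemma PeFenv_ge0 u : 0 <= Pe P U tau Fenv A u.
Proof.
rewrite PeE fine_ge0//; apply: integral_ge0 => w _; by rewrite lee_fin Fenv_ge0.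
Qed.

Lemma integral_PeFenv_le t :
  (\int[P]_w (Pe P U tau Fenv A (Uarr t w) `^ r)%:E <= (2 `^ r * V)%:E)%E.
Proof.
have mE : measurable_fun setT (fun x => (Fenv x `^ r)%:E).
  by apply/measurable_EFinP; exact: (measurableT_comp (measurable_powR r) mFenv).
have E0 x : (0 <= (Fenv x `^ r)%:E)%E by rewrite lee_fin powR_ge0.
have mI : measurable_fun setT (fun w => \int[P]_w' (Fenv (Sfill U tau A (Uarr t w) w') `^ r)%:E)%E.
  apply: (measurable_fun_fubini_tonelli_F (m2 := P)
    (fun z => (Fenv (Sfill U tau A (Uarr t z.1) z.2) `^ r)%:E)).
    exact: (measurableT_comp mE (measurable_Sfill_Uarr t A)).
  by move=> z; exact: E0.
rewrite EFinM -VE -(integral_Sfill t A mE E0) -ge0_integralZl_EFin//; last first.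
  by move=> w _; apply: integral_ge0.
apply: ae_ge0_le_integral_nomeas.
- by move=> w; rewrite lee_fin powR_ge0.
- by move=> w; rewrite mule_ge0 ?lee_fin ?powR_ge0//; apply: integral_ge0.
- exact: emeasurable_funM.
apply: filterS ae_good => w gw.
have := integral_powR_le r_ge1 (gw t A).
rewrite -PeE ger0_norm ?PeFenv_ge0// => h; apply: (le_trans h).
apply: lee_pmul => //.
  by apply: integral_ge0 => w' _; rewrite lee_fin powR_ge0.
rewrite le_eqVlt; apply/orP; left; apply/eqP; apply: eq_integral => w' _.
by rewrite ger0_norm ?Fenv_ge0.
Qed.

Let sigma (w : Om) : R := Num.sqrt (nn^-1 * vsum w).

Lemma vsum_ge0 w : 0 <= vsum w. Proof. exact: sqsum_ge0. Qed.

Lemma measurable_sigma : measurable_fun setT sigma.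
Proof.
rewrite (_ : sigma = fun w => (nn^-1 * vsum w) `^ 2^-1); last first.
  by apply/funext => w; rewrite /sigma powR12_sqrt// mulr_ge0 ?vsum_ge0// invr_ge0 ltW.
apply: (measurableT_comp (measurable_powR _)); apply: measurable_funM => //.
rewrite (_ : vsum = fun w => \sum_t (if p t then Pe P U tau Fenv A (Uarr t w) ^+ 2 else 0)).
  apply: measurable_sum => t; case: (p t); last exact: measurable_cst.
  by apply: measurable_funX; exact: measurable_PeFenv.
by apply/funext => w; rewrite /vsum /sqsum big_mkcond.
Qed.

(** The losses of Jensen's inequality: [2 ^ (r / 2)] for the empirical mean of the squares, [2 ^ r]
    for the conditional mean of the envelope. *)
Definition env_const : R := 2 `^ (r / 2) * 2 `^ r.

Lemma env_const_ge0 : 0 <= env_const. Proof. by rewrite mulr_ge0 ?powR_ge0. Qed.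

Lemma integral_sigma_le : (\int[P]_w (sigma w `^ r)%:E <= (env_const * V)%:E)%E.
Proof.
have r0 : 0 < r by exact: lt_le_trans ltr01 r_ge1.
(* The reason for the maximum with 2 in the exponent: an average of squares is raised to the power
   [r / 2]. *)
have r2 : 1 <= r / 2 by rewrite ler_pdivlMr// mul1r le_max lexx orbT.
have nnE : nn = #|in_slice (N := N) A|%:R by rewrite /nn -(card_in_slice A N_gt0).
have mG t : measurable_fun setT (fun w => (Pe P U tau Fenv A (Uarr t w) `^ r)%:E).
  by apply/measurable_EFinP; exact: (measurableT_comp (measurable_powR r) (measurable_PeFenv t)).
have cst0 : 0 <= 2 `^ (r / 2) * nn^-1 by rewrite mulr_ge0 ?powR_ge0// invr_ge0 ltW.
apply: (@le_trans _ _ (\int[P]_w ((2 `^ (r / 2) * nn^-1)%:E *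
    \sum_t (if p t then (Pe P U tau Fenv A (Uarr t w) `^ r)%:E else 0)))%E).
  apply: ge0_le_integral_nomeas => w _; first by rewrite lee_fin powR_ge0.
  rewrite -big_mkcond/= sumEFin -EFinM lee_fin.
  have -> : sigma w `^ r = (nn^-1 * vsum w) `^ (r / 2).
    rewrite /sigma -powR12_sqrt; last by rewrite mulr_ge0 ?vsum_ge0// invr_ge0 ltW.
    by rewrite -powRrM [2^-1 * _]mulrC.
  apply: le_trans (average_powR_le r2 nn_gt0 nnE _) _; first by move=> t _; exact: sqr_ge0.
  rewrite -mulrA ler_wpM2l ?powR_ge0// ler_wpM2l ?invr_ge0 ?(ltW nn_gt0)//.
  apply: ler_sum => t _; rewrite -powR_mulrn ?PeFenv_ge0// -powRrM.
  by rewrite mulrCA divff// mulr1.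
rewrite ge0_integralZl_EFin//; last 2 first.
- by move=> w _; apply: sume_ge0 => t _; case: ifP => // _; rewrite lee_fin powR_ge0.
- by apply: emeasurable_sum => t; case: (p t) => //; exact: measurable_cst.
rewrite ge0_integral_sum//; last 2 first.
- by move=> t; case: (p t) => //; exact: measurable_cst.
- by move=> t w _; case: ifP => // _; rewrite lee_fin powR_ge0.
apply: (@le_trans _ _ ((2 `^ (r / 2) * nn^-1)%:E * \sum_(t | p t) (2 `^ r * V)%:E)%E).
  apply: lee_pmul => //.
    by apply: sume_ge0 => t _; apply: integral_ge0 => w _; case: ifP => // _; rewrite lee_fin powR_ge0.
  rewrite [leRHS]big_mkcond/=; apply: lee_sum => t _; case: (boolP (p t)) => pt.
    exact: integral_PeFenv_le.
  by rewrite integral0.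
rewrite sumEFin -EFinM lee_fin sumr_const -[_ *+ #|_|]mulr_natr -nnE /env_const.
have -> : 2 `^ (r / 2) * nn^-1 * (2 `^ r * V * nn) = 2 `^ (r / 2) * 2 `^ r * V * (nn^-1 * nn) by ring.
by rewrite mulVf ?gt_eqF// mulr1.
Qed.

Lemma integral_sigma_powR_le :
  (\int[P]_w (sigma w `^ q)%:E <= (2 * (env_const * V) `^ (q / r))%:E)%E.
Proof.
have q0 : 0 < q by exact: lt_le_trans ltr01 q1.
have s1 : 1 <= r / q by rewrite ler_pdivlMr// mul1r le_max lexx.
have B0 : 0 <= env_const * V by rewrite mulr_ge0 ?env_const_ge0 ?V_ge0.
have msq : measurable_fun setT (fun w => sigma w `^ q).
  exact: (measurableT_comp (measurable_powR q) measurable_sigma).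
have := integral_root_le s1 B0 msq (fun w => powR_ge0 _ _).
rewrite invf_div; apply.
rewrite (eq_integral (fun w => (sigma w `^ r)%:E)); first exact: integral_sigma_le.
by move=> w _; rewrite -powRrM mulrC divfK// gt_eqF.
Qed.

Lemma sqrt_vsum w : Num.sqrt (vsum w) = Num.sqrt nn * sigma w.
Proof.
rewrite /sigma -sqrtrM; last exact: ltW.
by rewrite mulrA divff ?mul1r// gt_eqF.
Qed.

Hypothesis hJ :
  unif_entropy_integral #|A| [set Pe P U tau f A | f in Fcl] (Pe P U tau Fenv A) 1 = Jr%:E
  \/ V = 0.

(** If [V = 0], the integral of [sigma ^ r] vanishes, so almost every sample has a vanishing
    envelope and falls under the degenerate alternative of the chaining. *)
Lemma ae_entropy_or_vsum0 : {ae P, forall w,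
  unif_entropy_integral #|A| [set Pe P U tau f A | f in Fcl] (Pe P U tau Fenv A) 1 = Jr%:E
    \/ vsum w = 0}.
Proof.
case: hJ => [h|V0]; first by apply: aeW => w; left.
have msr : measurable_fun setT (fun w => (sigma w `^ r)%:E).
  by apply/measurable_EFinP; exact: (measurableT_comp (measurable_powR r) measurable_sigma).
have : (\int[P]_w `|(sigma w `^ r)%:E| = 0)%E.
  apply/eqP; rewrite eq_le; apply/andP; split; last by apply: integral_ge0 => w _; exact: abse_ge0.
  rewrite (eq_integral (fun w => (sigma w `^ r)%:E)) => [|w _]; last first.
    by rewrite gee0_abs// lee_fin powR_ge0.
  by apply: le_trans integral_sigma_le _; rewrite V0 mulr0.
move/(ae_eq_integral_abs P measurableT msr); apply: filterS => w /(_ I) h; right.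
have s0 : sigma w = 0 by exact: (powR_eq0_eq0 (EFin_inj h)).
have := sqrt_vsum w; rewrite s0 mulr0 => /eqP; rewrite sqrtr_eq0 => v0.
by apply/eqP; rewrite eq_le v0 vsum_ge0.
Qed.

(** The factors stem, in this order, from resampling, from the moments of the chaos, and from those
    of the envelope. *)
Definition total_const (k : nat) : R :=
  symm_const * (2 * chain_const R k m0 `^ q * (2 * env_const `^ (q / r))).

Lemma total_const_gt0 k : 0 < total_const k.
Proof.
have c0 : 0 < chain_const R k m0 by rewrite /chain_const ltr_wpDl// mulr_ge0// sqrtr_ge0.
by rewrite /total_const /symm_const /env_const !mulr_gt0 ?powR_gt0 ?mulr_gt0 ?powR_gt0// sub_card_gt0.
Qed.

Lemma integral_Hsup_real :
  (\int[P]_w Hsup w <= (total_const #|A| * (nn^-1 * Num.sqrt nn * Jr * V `^ r^-1) `^ q)%:E)%E.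
Proof.
have q0 : 0 < q by exact: lt_le_trans ltr01 q1.
have r0 : 0 < r by exact: lt_le_trans ltr01 r_ge1.
have J0 : 0 <= Jr by exact: le_trans ler01 Jr_ge1.
have D0 : 0 <= D by rewrite /D /chain_const addr_ge0// mulr_ge0// sqrtr_ge0.
pose E := {ffun 'I_K * 'I_m.+1 -> bool}.
have cE : (0 < #|{: E}|%:R :> R) by rewrite ltr0n; apply/card_gt0P; exists [ffun=> true].
pose c1 : R := nn^-1 `^ q * symm_const.
have c10 : 0 <= c1 by rewrite mulr_ge0 ?powR_ge0// mulr_ge0 ?powR_ge0// ltW// sub_card_gt0.
pose c2 : R := #|{: E}|%:R * (2 * (D * Jr * Num.sqrt nn) `^ q).
have c20 : 0 <= c2 by rewrite !mulr_ge0 ?powR_ge0.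
have mZ (eps : E) : measurable_fun setT (fun w => sym_sup eps (joint (bounded_U U (m := m)) w)).
  apply: (measurableT_comp (measurable_sym_sup eps)); apply: measurable_joint.
  by have [] := bounded_U_law K_gt0 iidU m.
have msq : measurable_fun setT (fun w => (sigma w `^ q)%:E).
  by apply/measurable_EFinP; exact: (measurableT_comp (measurable_powR q) measurable_sigma).
(* The left side of [integral_Hsup_le] is the same for every sign pattern. Summing over the patterns
   brings the sum under the integral, where the array is fixed. *)
have step1 : (#|{: E}|%:R%:E * \int[P]_w Hsup w <=
    c1%:E * \int[P]_w (\sum_(eps : E) sym_sup eps (joint (bounded_U U (m := m)) w)))%E.
  rewrite ge0_integral_sum//; last by move=> eps w _; exact: sym_sup_ge0.
  rewrite ge0_sume_distrr; last by move=> eps _; apply: integral_ge0 => w _; exact: sym_sup_ge0.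
  apply: le_trans (_ : (\sum_(eps : E) \int[P]_w Hsup w <= _)%E).
    rewrite sume_cst; exact: lexx.
  by apply: lee_sum => eps _; exact: integral_Hsup_le.
have step2 : (\int[P]_w (\sum_(eps : E) sym_sup eps (joint (bounded_U U (m := m)) w)) <=
    c2%:E * \int[P]_w (sigma w `^ q)%:E)%E.
  rewrite -ge0_integralZl_EFin//; last by move=> w _; rewrite lee_fin powR_ge0.
  apply: ae_ge0_le_integral_nomeas.
  - by move=> w; apply: sume_ge0 => eps _; exact: sym_sup_ge0.
  - by move=> w; rewrite mule_ge0// lee_fin powR_ge0.
  - exact: emeasurable_funM.
  apply: filterS2 ae_good ae_entropy_or_vsum0 => w gw hw.
  apply: le_trans (sum_sym_sup_le gw hw) _.
  rewrite -EFinM lee_fin /c2 -!mulrA ler_wpM2l// ler_wpM2l//.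
  rewrite sqrt_vsum -powRM ?sqrtr_ge0//; last by rewrite !mulr_ge0 ?sqrtr_ge0.
  by rewrite le_eqVlt; apply/orP; left; apply/eqP; congr (_ `^ _); ring.
(* The number of sign patterns also occurs in [c2], so it leaves no trace in the constant. *)
rewrite -(lee_pmul2l (x := #|{: E}|%:R%:E))// ?lte_fin//.
apply: (le_trans step1).
apply: (@le_trans _ _ (c1%:E * (c2%:E * (2 * (env_const * V) `^ (q / r))%:E))%E).
  apply: lee_pmul => //.
    by apply: integral_ge0 => w _; apply: sume_ge0 => eps _; exact: sym_sup_ge0.
  apply: (le_trans step2); apply: lee_pmul => //; last exact: integral_sigma_powR_le.
  by apply: integral_ge0 => w _; rewrite lee_fin powR_ge0.
rewrite -!EFinM lee_fin le_eqVlt; apply/orP; left; apply/eqP.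
rewrite /c1 /c2 /total_const -/D.
have nn0 : 0 <= nn^-1 by rewrite invr_ge0 ltW.
rewrite !powRM ?mulr_ge0 ?sqrtr_ge0 ?powR_ge0 ?env_const_ge0 ?V_ge0//.
by rewrite -[V `^ r^-1 `^ q]powRrM [r^-1 * q]mulrC; ring.
Qed.

End MaximalInequality.

(** * Enumeration of the class and assembly of the theorem *)

Lemma pointwise_measurable_seq (R : realType) (S : Type) (F : set (S -> R)) :
  pointwise_measurable F -> F !=set0 ->
  exists g : nat -> S -> R, (forall n, F (g n)) /\
    forall f, F f -> exists h : nat -> nat, forall x, g (h n) x @[n --> \oo] --> f x.
Proof.
move=> [F' [cF' [F'F lim]]] [f0 Ff0].
have [g0 [F'g0 _]] := lim f0 Ff0.
have /pfcard_geP[F'0|/surjfunPex[g gE]] := cF'.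
  by have := F'g0 0%N; rewrite F'0.
exists g; split; first by move=> n; apply: F'F; rewrite gE; exists n.
move=> f Ff; have [u [F'u uf]] := lim f Ff.
have /choice[h hE] n : exists i, g i = u n.
  by have := F'u n; rewrite gE => -[i _ <-]; exists i.
by exists h => x; under eq_fun do rewrite hE; exact: uf.
Qed.

Theorem theorem2p1 (R : realType) (K k : nat) (q : R) :
  (1 <= k)%N -> (k <= K)%N -> 1 <= q ->
  exists C : R, 0 < C /\
  forall (d : measure_display) (S : measurableType d)
         (dO : measure_display) (Om : measurableType dO)
         (P : probability Om R)
         (U : idx K -> Om -> R) (tau : famT R K -> S)
         (Fcl : set (S -> R)) (Fenv : S -> R)
         (N : 'I_K -> nat) (A : sub K),
    (* the U_{i.e}, i in N^K, e in {0,1}^K \ {0}, are i.i.d. *)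
    iid P [set v : idx K | v != zero_idx K] U ->
    (* tau is Borel measurable *)
    measurable_fun setT tau ->
    (* F : pointwise measurable class of measurable functions, envelope Fenv *)
    pointwise_measurable Fcl ->
    (forall f, Fcl f -> measurable_fun setT f) ->
    envelope Fcl Fenv -> measurable_fun setT Fenv ->
    (* E[f(X_1)] = 0 for all f in F *)
    (forall f, Fcl f ->
       P.-integrable setT (fun w => (f (Xarr U tau (one_idx K) w))%:E) /\
       (\int[P]_w (f (Xarr U tau (one_idx K) w))%:E = 0)%E) ->
    (* sample size N = (N_1,...,N_K), N_j >= 1 *)
    (forall j, (0 < N j)%N) ->
    (* e in E_k *)
    #|A| = k ->
    ((Num.sqrt (cardI N A)%:R)%:E *
       ((\int[P]_w ereal_sup [set (`|Hen P U tau N f A w| `^ q)%:E | f in Fcl])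
          `^ q^-1%R)
     <=
     C%:E * unif_entropy_integral k [set Pe P U tau f A | f in Fcl] (Pe P U tau Fenv A) 1
       * (\int[P]_w ((Fenv (Xarr U tau (one_idx K) w)) `^ (Num.max q 2)%R)%:E)
            `^ (Num.max q 2)%R^-1)%E.
Proof.
move=> k1 kK q1.
have K_gt0 : (0 < K)%N by exact: leq_trans k1 kK.
have q0 : 0 < q by exact: lt_le_trans ltr01 q1.
(* An even moment order [2 m0] above [q] that depends on [q] alone. *)
pose m0 := (Num.truncn q).+1.
have qm0 : q <= m0.*2%:R.
  apply: (@le_trans _ _ m0%:R); first by rewrite ltW// truncnS_gt.
  by rewrite ler_nat -addnn leq_addr.
have c0 : 0 < total_const (K := K) q m0 k by exact: total_const_gt0.
exists (total_const (K := K) q m0 k `^ q^-1); split; first exact: powR_gt0.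
move=> d S dO Om P U tau Fcl Fenv N A iidU mtau pF Fmeas Fenvl mFenv Fcent N_gt0 cardA.
set C := _ `^ q^-1.
have C0 : 0 < C by exact: powR_gt0.
set J := unif_entropy_integral _ _ _ _.
set H := (\int[P]_w ereal_sup _)%E.
set VV := (\int[P]_w (Fenv _ `^ _)%:E)%E.
set r := Num.max q 2.
have r0 : 0 < r by rewrite lt_max q0.
have r'0 : r^-1 != 0 by rewrite invr_eq0 gt_eqF.
have J1 : (1 <= J)%E.
  (* The point mass at the zero family serves as a discrete probability. *)
  apply: (@unif_entropy_integral_ge1 _ _ _ _ _ [:: (fun=> 0, 1)]); split.
    by move=> x [<-|[]] /=.
  by rewrite big_seq1.
have J0 : (0 <= J)%E by exact: le_trans lee01 J1.
have V0 : (0 <= VV)%E by apply: integral_ge0 => w _; rewrite lee_fin powR_ge0.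
have CJ0 : (0 < C%:E * J)%E by rewrite mule_gt0// (lt_le_trans lte01).
(* For an empty class the supremum is [-oo], and so is its integral; the power [q^-1] sends [-oo] to
   0. *)
have [[f0 Ff0]|F0] := pselect (Fcl !=set0); last first.
  have FE : Fcl = set0.
    by apply/seteqP; split => // f Ff; exfalso; apply: F0; exists f.
  have -> : H = -oo%E.
    rewrite /H (eq_integral (cst -oo%E)) => [|w _]; last by rewrite FE image_set0 ereal_sup0.
    rewrite integral_cst// -[RHS]mule1; congr (_ * _)%E; exact: probability_setT.
  rewrite poweRNyr ?mule0; last by rewrite invr_eq0 gt_eqF.
  by apply: mule_ge0; [exact: ltW|exact: poweR_ge0].
have [Vfin|] := boolP (VV \is a fin_num); last first.
  rewrite ge0_fin_numE// -leNgt leye_eq => /eqP ->.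
  by rewrite poweRyr// gt0_muley// leey.
set V := fine VV; have VE : VV = V%:E by rewrite fineK.
(* In this case the right side is [+oo]. *)
have [JVoo|JV] := pselect (J = +oo%E /\ V != 0).
  have [-> Vn0] := JVoo.
  have Vp : 0 < V by rewrite lt_def Vn0 fine_ge0.
  by rewrite gt0_muley ?lte_fin// VE poweR_EFin gt0_mulye ?lte_fin ?powR_gt0// leey.
(* The default 1 is used only when [V = 0]; then the bound in [main] is 0 whatever [Jr] is, and the
   right side is 0 by the convention [+oo * 0 = 0]. *)
pose Jr := if J \is a fin_num then fine J else 1.
have hJ : J = Jr%:E \/ V = 0.
  rewrite /Jr; case: ifPn => [Jf|]; first by left; rewrite fineK.
  rewrite ge0_fin_numE// -leNgt leye_eq => /eqP Joo; right.
  by apply: contrapT => /eqP Vn0; apply: JV.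
have Jr1 : 1 <= Jr.
  by rewrite /Jr; case: ifPn => // Jf; rewrite -lee_fin fineK.
have [g [gF Fg]] := pointwise_measurable_seq pF (ex_intro _ f0 Ff0).
have hJ' : unif_entropy_integral #|A| [set Pe P U tau f A | f in Fcl] (Pe P U tau Fenv A) 1 = Jr%:E
  \/ V = 0 by rewrite cardA.
have main := integral_Hsup_real K_gt0 iidU mtau Fmeas Fenvl mFenv
  (fun f Ff => proj2 (Fcent f Ff)) gF Fg N_gt0 q1 VE (ltn0Sn _) qm0 Jr1 hJ'.
rewrite cardA in main.
have H0 : (0 <= H)%E by apply: integral_ge0 => w _; exact: (Hsup_ge0 _ _ _ _ _ _ gF).
set nn : R := (cardI N A)%:R in main *.
have nn0 : 0 < nn by rewrite ltr0n prodn_gt0.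
have Jr0 : 0 <= Jr by exact: le_trans ler01 Jr1.
set y := nn^-1 * Num.sqrt nn * Jr * V `^ r^-1 in main.
have y0 : 0 <= y.
  by rewrite /y !mulr_ge0 ?powR_ge0 ?sqrtr_ge0 ?invr_ge0 ?(ltW nn0).
have main' : (H `^ q^-1 <= (C * y)%:E)%E.
  apply: le_trans (gt0_ler_poweR _ _ _ main) _.
  - by rewrite invr_ge0 ltW.
  - by rewrite in_itv/= H0 leey.
  - by rewrite in_itv/= leey andbT lee_fin mulr_ge0 ?powR_ge0 ?(ltW c0).
  - by rewrite poweR_EFin powRM ?powR_ge0 ?(ltW c0)// -powRrM divff ?gt_eqF// powRr1.
apply: (@le_trans _ _ ((Num.sqrt nn)%:E * (C * y)%:E)%E).
  by apply: lee_pmul => //; rewrite ?poweR_ge0 ?lee_fin ?sqrtr_ge0.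
rewrite -EFinM.
have -> : Num.sqrt nn * (C * y) = C * Jr * V `^ r^-1.
  rewrite /y.
  have -> : Num.sqrt nn * (C * (nn^-1 * Num.sqrt nn * Jr * V `^ r^-1)) =
    (Num.sqrt nn ^+ 2 * nn^-1) * (C * Jr * V `^ r^-1) by ring.
  by rewrite sqr_sqrtr ?(ltW nn0)// divff ?mul1r// gt_eqF.
case: hJ => [->|Vz].
  by rewrite VE poweR_EFin -!EFinM lexx.
by rewrite VE Vz poweR_EFin powR0// mulr0 mule0.
Qed.
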